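(* Let $G$ be a simple plane graph with $\Delta(G)\ge11$, and let $L$ assign to each vertex of $G$ a list of $\Delta(G)$ colors and to each edge of $G$ a list of $\Delta(G)+2$ colors. Then $G$ has a total $L$-coloring.
   Context: $\Delta(G)$ is the maximum degree. A total $L$-coloring assigns to each vertex and each edge a color from its list such that any two adjacent vertices, any two edges sharing an endpoint, and any vertex and an edge incident to it receive distinct colors. *)

(* Defs.v *)
From HB Require Import structures.
From mathcomp Require Import all_boot all_order all_algebra finmap.
From mathcomp Require Import mathcomp_extra boolp classical_sets set_interval.
From mathcomp Require Import reals topology normedtype.

Set Implicit Arguments.
Unset Strict Implicit.
Unset Printing Implicit Defensive.

Import Order.TTheory GRing.Theory Num.Theory.
Import numFieldNormedType.Exports.

Local Open Scope ring_scope.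

Record sgraph := SGraph {
  vertex :> finType;
  adj : rel vertex;
  adj_sym : symmetric adj;
  adj_irrefl : irreflexive adj
}.

(* An edge is the two-element set of its endpoints. *)
Definition edges (G : sgraph) : {set {set G}} :=
  [set e : {set G} | [exists x, exists y, adj x y && (e == [set x; y])]]%SET.

Definition degree (G : sgraph) (x : G) : nat := #|[pred y | adj x y]|.

Definition max_degree (G : sgraph) : nat := (\max_(x : G) degree x)%N.

(* Vertices are distinct points of R^2; every edge is an arc (a continuous
   injective image of [0, 1]) joining the points of its two ends, and the
   interior of an edge contains no vertex and no point of any other edge.
   [edge_arc e] is constrained only when [e] is an edge, and only on [0, 1]. *)
Record plane_graph (R : realType) := PlaneGraph {
  plane_sgraph :> sgraph;
  point : plane_sgraph -> R * R;
  edge_arc : {set plane_sgraph} -> R -> R * R;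
  point_inj : injective point;
  edge_arc_continuous : forall e, e \in edges plane_sgraph ->
    {within `[0, 1], continuous (edge_arc e)}%classic;
  edge_arc_inj : forall e, e \in edges plane_sgraph ->
    {in `[0, 1] &, injective (edge_arc e)};
  edge_arc_ends : forall e, e \in edges plane_sgraph ->
    exists x y, [/\ e = [set x; y]%SET,
      edge_arc e 0 = point x & edge_arc e 1 = point y];
  edge_arc_vertex : forall e, e \in edges plane_sgraph ->
    forall t : R, t \in `]0, 1[ -> forall x, edge_arc e t <> point x;
  edge_arc_disjoint : forall e f, e \in edges plane_sgraph ->
    f \in edges plane_sgraph -> e <> f ->
    forall s t : R, s \in `]0, 1[ -> t \in `[0, 1] -> edge_arc e s <> edge_arc f t
}.

(* [LV], [LE] are the lists of the vertices and of the edges; values of [LE]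
   and [cE] at sets that are not edges are irrelevant. *)
Definition total_list_coloring (G : sgraph) (C : choiceType)
    (LV : G -> {fset C}) (LE : {set G} -> {fset C})
    (cV : G -> C) (cE : {set G} -> C) : Prop :=
  [/\ (forall x, cV x \in LV x) /\
      (forall e, e \in edges G -> cE e \in LE e),
      forall x y, adj x y -> cV x <> cV y,
      forall e f x, e \in edges G -> f \in edges G -> e <> f ->
        x \in e -> x \in f -> cE e <> cE f
    & forall x e, e \in edges G -> x \in e -> cV x <> cE e].

(* Main.v *)
Require Import Defs.
From mathcomp Require Import all_boot all_order all_algebra finmap reals.
From mathcomp Require Import zify lra.

(** An edge [xy] with [d x <= 5] and [d x + d y <= Delta + 2] is reducible: colour
    the graph without it, then choose a colour for [xy] (at most [Delta + 1] are
    forbidden once the colour of [x] is dropped) and a new one for [x] (at most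
    [2 * 5 < Delta] are forbidden).  Every edge at a vertex of degree at most 2 is of
    this kind, and otherwise one exists by a weak form of Kotzig's theorem: a plane
    graph of minimum degree at least 3 has an edge [xy] with [d x <= 5] and
    [d x + d y <= 13].

    Kotzig's theorem is proved by discharging, and the only input from planarity is
    an abstract dual over F_2: a map from darts to faces for which cycles are the
    cuts between faces.  It gives Euler's inequality by a rank count, and it gives
    the incidences needed for discharging because every face boundary is an even
    subgraph; no rotation system is used.

    To obtain the dual, the drawing is rounded to a fine square grid.  By compactness
    the graph becomes a minor of the grid: large squares around the vertices,
    together with the parts of the edges leading out of them, are disjoint connected
    branch sets.  A cycle of the graph lifts to a cycle of the grid, which is the
    boundary of the set of cells from which a horizontal ray crosses it an odd
    number of times; the faces are the classes of cells that cannot be told apart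
    by functions constant across the grid edges outside the minor. *)

Set Implicit Arguments.
Unset Strict Implicit.
Unset Printing Implicit Defensive.

(** * Removing a light edge *)

Definition rdeg (V : finType) (a : rel V) (x : V) : nat := #|[pred y | a x y]|.

Lemma fset_avoid (C : choiceType) (A : {fset C}) (s : seq C) :
  size s < #|` A| -> exists2 c, c \in A & c \notin s.
Proof.
move=> lt_sA; case: (boolP (has [pred c | c \notin s] (enum_fset A))).
  by case/hasP=> c cA cs; exists c.
move/hasPn=> sub; suff: size (enum_fset A) <= size s by rewrite leqNgt lt_sA.
by apply: uniq_leq_size (fset_uniq A) _ => c /sub; rewrite negbK.
Qed.

Lemma set2_eql (T : finType) (x y z : T) : [set x; y] = [set x; z] -> y = z.
Proof.
move=> eq_xy; have := set22 x y; rewrite eq_xy !inE => /orP[] /eqP // yx.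
by have := set22 x z; rewrite -eq_xy yx setUid inE => /eqP.
Qed.

Section ColourByLightEdges.

Variables (G : sgraph) (x0 : G) (C : choiceType) (k : nat).
Variables (LV : G -> {fset C}) (LE : {set G} -> {fset C}).
Hypothesis k_ge11 : 11 <= k.
Hypothesis card_LV : forall x, #|` LV x| = k.
Hypothesis card_LE : forall e, e \in edges G -> #|` LE e| = k + 2.

(** Total colourings of the spanning subgraph of [G] with adjacency [a]. Colours stay indexed by the
    vertices and edges of [G], so deleting an edge changes [a] and leaves the lists alone. *)
Definition total_coloring_rel (a : rel G) (cV : G -> C) (cE : {set G} -> C) :=
  [/\ forall x, cV x \in LV x,
      forall x y, a x y -> cE [set x; y] \in LE [set x; y],
      forall x y, a x y -> cV x <> cV y,
      forall x y z, a x y -> a x z -> y <> z ->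
        cE [set x; y] <> cE [set x; z]
    & forall x y, a x y -> cV x <> cE [set x; y]].

Definition del_edge (a : rel G) (x y : G) : rel G :=
  [rel u v | a u v && ([set u; v] != [set x; y])].

(** With the colour of [x] dropped, [xy] sees the colour of [y] and [rdeg a x + rdeg a y - 2] edges,
    so at most [k + 1] colours. Then [x] sees at most 5 vertices and 5 edges, while [k >= 11]. *)
Lemma extend_coloring (a : rel G) (x y : G) cV cE :
  symmetric a -> subrel a (@adj G) -> a x y ->
  rdeg a x <= 5 -> rdeg a x + rdeg a y <= k + 2 ->
  total_coloring_rel (del_edge a x y) cV cE ->
  exists cV' cE', total_coloring_rel a cV' cE'.
Proof.
move=> sym_a sub_a axy dx5 dxy [lV lE pV pE pVE].
have ne_adj u v : a u v -> u <> v.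
  by move=> /sub_a auv eq_uv; rewrite eq_uv adj_irrefl in auv.
have xy := ne_adj _ _ axy.
have exy : [set x; y] \in edges G.
  by rewrite inE; apply/existsP; exists x; apply/existsP; exists y;
    rewrite (sub_a _ _ axy) eqxx.
pose nb u v := [seq w <- enum (a u) | w != v].
have size_nb u v : a u v -> (size (nb u v)).+1 = rdeg a u.
  move=> auv; have -> : rdeg a u = size (enum (a u)) by rewrite /rdeg cardE.
  have: count_mem v (enum (a u)) = 1.
    by rewrite count_uniq_mem ?enum_uniq // mem_enum unfold_in auv.
  rewrite -(count_predC (pred1 v) (enum (a u))) size_filter => ->.
  by rewrite add1n.
have [c cL cF] : exists2 c, c \in LE [set x; y] &
   c \notin cV y :: [seq cE [set x; w] | w <- nb x y]
        ++ [seq cE [set y; w] | w <- nb y x].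
  apply: fset_avoid; rewrite card_LE //= size_cat !size_map.
  have := size_nb _ _ axy; have := size_nb y x; rewrite sym_a => /(_ axy).
  move: (size (nb x y)) (size (nb y x)) (rdeg a x) (rdeg a y) dxy; lia.
pose cE' e := if e == [set x; y] then c else cE e.
have [d dL dF] : exists2 d, d \in LV x &
   d \notin [seq cV w | w <- enum (a x)] ++ [seq cE' [set x; w] | w <- enum (a x)].
  apply: fset_avoid; rewrite card_LV size_cat !size_map -cardE.
  by rewrite -[#|_|]/(rdeg a x); move: (rdeg a x) dx5; lia.
pose cV' u := if u == x then d else cV u.
have delP u v : a u v -> [set u; v] != [set x; y] -> del_edge a x y u v.
  by move=> auv ne; rewrite /del_edge /= auv.
have dV w : a x w -> d <> cV w.
  move=> axw eqd; move/negP: dF; apply; rewrite mem_cat; apply/orP; left.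
  by apply/mapP; exists w; rewrite ?mem_enum.
have dE w : a x w -> d <> cE' [set x; w].
  move=> axw eqd; move/negP: dF; apply; rewrite mem_cat; apply/orP; right.
  by apply/mapP; exists w; rewrite ?mem_enum.
have cVy : c <> cV y by move=> eqc; move: cF; rewrite eqc inE eqxx.
have cx w : a x w -> w <> y -> c <> cE [set x; w].
  move=> axw wy eqc; move/negP: cF; apply; rewrite inE mem_cat; apply/orP; right.
  apply/orP; left; apply/mapP; exists w => //.
  by rewrite mem_filter mem_enum; apply/andP; split=> //; apply/eqP.
have cy w : a y w -> w <> x -> c <> cE [set y; w].
  move=> axw wy eqc; move/negP: cF; apply; rewrite inE mem_cat; apply/orP; right.
  apply/orP; right; apply/mapP; exists w => //.
  by rewrite mem_filter mem_enum; apply/andP; split=> //; apply/eqP.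
have new_vs_old u v w : a u v -> a u w -> v <> w -> [set u; v] = [set x; y] ->
    c <> cE [set u; w].
  move=> auv auw vw euv; have: u \in [set x; y] by rewrite -euv set21.
  rewrite !inE => /orP[] /eqP eu; subst u.
    by move/set2_eql: euv => ev; subst v; apply: cx => // /esym.
  by rewrite [RHS]setUC in euv; move/set2_eql: euv => ev; subst v; apply: cy => // /esym.
exists cV', cE'; split.
- by move=> u; rewrite /cV'; case: eqP => [->|].
- move=> u v auv; rewrite /cE'; case: eqP => [->|/eqP ne] //.
  by apply: lE; apply: delP.
- move=> u v auv; rewrite /cV'.
  have [ux|ux] := eqVneq u x.
    have [vx|vx] := eqVneq v x; first by case: (ne_adj _ _ auv); rewrite ux.
    by apply: dV; rewrite -ux.
  have [vx|vx] := eqVneq v x.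
    by move/esym; apply: dV; rewrite -vx sym_a.
  apply: pV; apply: delP => //; apply/eqP=> euv.
  have: x \in [set u; v] by rewrite euv set21.
  by rewrite !inE ![x == _]eq_sym (negbTE ux) (negbTE vx).
- move=> u v w auv auw vw; rewrite /cE'.
  have [euv|nuv] := eqVneq [set u; v] [set x; y].
    have [euw|nuw] := eqVneq [set u; w] [set x; y].
      by case: vw; apply: (@set2_eql _ u); rewrite euv.
    exact: (@new_vs_old u v w).
  have [euw|nuw] := eqVneq [set u; w] [set x; y].
    by move/esym; apply: (@new_vs_old u w v) => // /esym.
  by apply: pE => //; apply: delP.
- move=> u v auv; rewrite /cV'; case: eqP => [ux|/eqP ux].
    by subst u; apply: dE.
  rewrite /cE'; case: eqP => [euv|/eqP nuv]; last by apply: pVE; apply: delP.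
  have: u \in [set x; y] by rewrite -euv set21.
  by rewrite !inE (negbTE ux) => /eqP-> /esym.
Qed.

Lemma total_coloring_of_light_edges :
  (forall a : rel G, symmetric a -> subrel a (@adj G) ->
     (exists x y, a x y) ->
     exists x y, [/\ a x y, rdeg a x <= 5 & rdeg a x + rdeg a y <= k + 2]) ->
  exists cV cE, total_list_coloring LV LE cV cE.
Proof.
move=> light.
(* Induction on a bound for the number of darts, over all subgraphs of [G]; hence light edges are
   required in each of them. *)
have step n (a : rel G) : symmetric a -> subrel a (@adj G) ->
    #|[pred p : G * G | a p.1 p.2]| <= n -> exists cV cE, total_coloring_rel a cV cE.
  elim: n a => [|n IHn] a sym_a sub_a.
  - rewrite leqn0 => /eqP/card0_eq a0.
    have a00 x y : a x y = false by have := a0 (x, y); rewrite !inE.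
    have col x : exists c, c \in LV x.
      have [|c cL _] := @fset_avoid _ (LV x) [::]; last by exists c.
      by rewrite card_LV /=; lia.
    exists (fun x => xchoose (col x)).
    (* Without edges any edge colour will do; [x0] supplies some element of [C]. *)
    exists (fun=> xchoose (col x0)); split=> x; rewrite ?a00 //.
    + exact: xchooseP.
    + by move=> y; rewrite a00.
    + by move=> y; rewrite a00.
    + by move=> y z; rewrite a00.
    + by move=> y; rewrite a00.
  move=> le_an.
  case: (pickP [pred p : G * G | a p.1 p.2]) => [[x1 y1] /= a1|a0]; last first.
    by apply: IHn => //; rewrite (eq_card0 a0).
  have [|x [y [axy dx dxy]]] := light a sym_a sub_a; first by exists x1, y1.
  have [|||cV [cE col]] := IHn (del_edge a x y).
  - by move=> u v; rewrite /del_edge /= sym_a setUC.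
  - by move=> u v /andP[/sub_a].
  - rewrite -ltnS; apply: leq_trans le_an; apply: proper_card; apply/properP; split.
      by apply/subsetP=> p; rewrite !inE => /andP[].
    by exists (x, y); rewrite !inE //= /del_edge /= eqxx andbF.
  exact: extend_coloring col.
have [//|cV [cE [lV lE pV pE pVE]]] := step _ (@adj G) (@adj_sym G) _ (leqnn _).
have edgeP e x : e \in edges G -> x \in e -> exists2 y, adj x y & e = [set x; y].
  rewrite inE => /existsP[u /existsP[v /andP[uv /eqP->]]].
  rewrite !inE => /orP[] /eqP->; first by exists v.
  by exists u; rewrite 1?adj_sym // setUC.
exists cV, cE; split=> //.
- split=> // e; rewrite inE => /existsP[u /existsP[v /andP[uv /eqP->]]].
  exact: lE.
- move=> e f x eE fE ef xe xf.
  have [y xy ey] := edgeP _ _ eE xe; have [z xz ez] := edgeP _ _ fE xf.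
  by rewrite ey ez; apply: pE => // yz; case: ef; rewrite ey ez yz.
- by move=> x e eE xe; have [y xy ->] := edgeP _ _ eE xe; apply: pVE.
Qed.

End ColourByLightEdges.

(** * Abstract duals and Euler's inequality *)

Import GRing.Theory.

(** Proves that an explicit list of pairs is duplicate-free: each disequality of the context is used
    in both directions, then cleared. *)
Ltac neq_uniq :=
  rewrite /= !inE !xpair_eqE;
  repeat match goal with H : is_true (?x != ?y) |- _ =>
    rewrite ?(negbTE H) ?[y == x]eq_sym ?(negbTE H); clear H end;
  rewrite ?andbF ?andFb ?orbF.

Lemma F2_addxx (x : 'F_2) : (x + x = 0)%R.
Proof. by rewrite -mulr2n -mulr_natr char_Zp // mulr0. Qed.

Lemma F2_natb_add (b c : bool) : (b%:R + c%:R = (b (+) c)%:R :> 'F_2)%R.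
Proof. by case: b; case: c; rewrite ?addr0 ?add0r // F2_addxx. Qed.

Lemma F2_natr_odd n : (n%:R = (odd n)%:R :> 'F_2)%R.
Proof. by elim: n => //= n IHn; rewrite -natr1 IHn (F2_natb_add _ true) addbT. Qed.

Lemma F2_natr_eq0 n : (n%:R == 0 :> 'F_2)%R = ~~ odd n.
Proof. by rewrite F2_natr_odd; case: odd. Qed.

(* [face x y] plays the role of the face to the left of the dart from [x] to
   [y].  The two clauses say that the cycle space of the graph over F_2 is the
   cut space of the graph joining, for every edge, the faces on its two sides. *)
Definition abstract_dual (V F : finType) (a : rel V) (face : V -> V -> F) :=
  (forall (chi : F -> 'F_2) x,
     \sum_(y | a x y) (chi (face x y) + chi (face y x)) = 0)%R /\
  (forall z : V -> V -> 'F_2,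
     (forall x y, z x y = z y x) -> (forall x y, ~~ a x y -> z x y = 0%R) ->
     (forall x, \sum_y z x y = 0)%R ->
     exists chi : F -> 'F_2,
       forall x y, a x y -> z x y = (chi (face x y) + chi (face y x))%R).

Section Dual.

Variables (V F : finType) (a : rel V) (face : V -> V -> F).
Hypotheses (sym_a : symmetric a) (irr_a : irreflexive a).
Hypothesis dual : abstract_dual a face.

(** The exclusive or drops the edges with [f] on both sides, so bridges lie on no boundary. *)
Definition boundary (f : F) : rel V :=
  [rel x y | a x y && ((face x y == f) (+) (face y x == f))].

Lemma boundary_sym f : symmetric (boundary f).
Proof. by move=> x y; rewrite /boundary /= sym_a addbC. Qed.

Lemma boundary_neq f x y : boundary f x y -> x != y.
Proof. by move=> /andP[axy _]; apply: contraTneq axy => ->; rewrite irr_a. Qed.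

(** The cut clause of the dual, applied to the indicator function of [f]. *)
Lemma boundary_even f x : ~~ odd (rdeg (boundary f) x).
Proof.
have := dual.1 (fun g => (g == f)%:R)%R x.
under eq_bigr do rewrite F2_natb_add.
rewrite -natr_sum => /eqP; rewrite F2_natr_eq0; congr (~~ odd _).
rewrite /rdeg -sum1_card [LHS]big_mkcond [RHS]big_mkcond /=.
by apply: eq_bigr => y _; rewrite !inE /boundary /=; case: (a x y) => //=; case: addb.
Qed.

Lemma boundary_next f x y : boundary f x y -> exists2 z, boundary f x z & z != y.
Proof.
move=> bxy; have: 1 < rdeg (boundary f) x.
  have: 0 < rdeg (boundary f) x by apply/card_gt0P; exists y.
  by have := boundary_even f x; case: rdeg => [|[]].
case/card_gt1P=> z [t []]; rewrite !inE => bxz bxt zt.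
have [zy|zy] := eqVneq z y; last by exists z.
by exists t => //; rewrite -zy eq_sym.
Qed.

Lemma sum_rdeg (b : rel V) : \sum_x rdeg b x = #|[pred p : V * V | b p.1 p.2]|.
Proof.
rewrite -sum1_card -(pair_big_dep xpredT b (fun _ _ => 1)) /=.
by apply: eq_bigr => x _; rewrite sum1_card.
Qed.

Lemma sum_rdeg_ge (b : rel V) (s : seq (V * V)) :
  uniq s -> all [pred p | b p.1 p.2] s -> size s <= \sum_x rdeg b x.
Proof.
move=> us /allP sb; rewrite sum_rdeg cardE; apply: uniq_leq_size => // p ps.
by rewrite mem_enum; apply: sb.
Qed.

(** Continuing the boundary beyond both ends of [xy] gives three distinct edges [xy], [xz], [yw],
    hence six darts; [z = w] is possible. *)
Lemma boundary_length_ge3 f x y :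
  boundary f x y -> 6 <= \sum_x rdeg (boundary f) x.
Proof.
move=> bxy; have byx : boundary f y x by rewrite boundary_sym.
have [z bxz zy] := boundary_next bxy; have [w byw wx] := boundary_next byx.
have xy := boundary_neq bxy; have xz := boundary_neq bxz.
have yw := boundary_neq byw.
apply: (@sum_rdeg_ge _ [:: (x, y); (y, x); (x, z); (z, x); (y, w); (w, y)]).
  by neq_uniq.
by rewrite /= bxy byx bxz byw boundary_sym bxz boundary_sym byw.
Qed.


Definition oriented_edges : {set V * V} :=
  [set p | a p.1 p.2 && (enum_rank p.1 < enum_rank p.2)].
Definition nonisolated : {set V} := [set x | 0 < rdeg a x].
Definition proper_faces : {set F} := [set f | [exists x, exists y, boundary f x y]].

Lemma sum_rdeg_edges : \sum_x rdeg a x = 2 * #|oriented_edges|.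
Proof.
rewrite sum_rdeg mul2n -addnn.
pose swap (p : V * V) := (p.2, p.1).
have swapK : involutive swap by case.
have sw x y : ((x, y) \in swap @: oriented_edges) = ((y, x) \in oriented_edges).
  by rewrite -[(x, y)]/(swap (y, x)) mem_imset //; apply: inv_inj.
have <- : #|[set swap p | p in oriented_edges]| = #|oriented_edges|.
  by apply: card_imset; apply: inv_inj.
rewrite [X in (X + _)%N](_ : _ = #|oriented_edges|); last first.
  by apply: card_imset; apply: inv_inj.
rewrite -cardsUI [X in (_ + X)%N](_ : _ = 0) ?addn0.
  apply: eq_card => -[x y]; rewrite !inE /=.
  rewrite sw !inE /= [a y x]sym_a -andb_orr; case axy: (a x y) => //=.
  have: enum_rank x != enum_rank y.
    by rewrite (inj_eq enum_rank_inj); apply: contraTneq axy => ->; rewrite irr_a.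
  by rewrite -neq_ltn.
apply: eq_card0 => -[x y]; rewrite !inE /=.
rewrite sw !inE /=; apply/negP=> /andP[/andP[_ lt1] /andP[_ lt2]].
by have := ltn_trans lt1 lt2; rewrite ltnn.
Qed.

(* The cycle space has dimension at least E - V + 1, and it is spanned by the
   boundaries of the proper faces. *)
Lemma euler_inequality :
  (exists x y, a x y) -> #|oriented_edges| < #|nonisolated| + #|proper_faces|.
Proof.
move=> [x0 [y0 a0]].
pose nE := #|oriented_edges|; pose nV := #|nonisolated|; pose nF := #|proper_faces|.
(* [M] is the edge-vertex incidence matrix; the rows of [D] are the boundaries of the proper faces
   as vectors of edges. *)
pose M : 'M['F_2]_(nE, nV) :=
  (\matrix_(i, j) ((enum_val j == (enum_val i).1) (+) (enum_val j == (enum_val i).2))%:R)%R.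
pose D : 'M['F_2]_(nF, nE) :=
  (\matrix_(k, i) (boundary (enum_val k) (enum_val i).1 (enum_val i).2)%:R)%R.
have edgeP (i : 'I_nE) : a (enum_val i).1 (enum_val i).2 /\
    enum_rank (enum_val i).1 < enum_rank (enum_val i).2.
  by have := enum_valP i; rewrite inE => /andP[].
have pairE (e : V * V) x y : (e == (x, y)) = (e.1 == x) && (e.2 == y) by case: e.
have a_noniso x y : a x y -> x \in nonisolated.
  by move=> axy; rewrite inE; apply/card_gt0P; exists y.
have sum_noniso (g : V -> 'F_2) :
    (\sum_(j < nV) g (enum_val j) = \sum_(x in nonisolated) g x)%R.
  by rewrite [RHS]big_enum_val.
(* Every edge has two ends, so over F_2 the all-one vector is killed by [M]. *)
have rank_M : \rank M < nV.
  have M1 : (M *m const_mx 1 = 0 :> 'cV_nE)%R.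
    apply/matrixP=> i j; rewrite !mxE; under eq_bigr do rewrite !mxE mulr1.
    rewrite (sum_noniso (fun x => ((x == (enum_val i).1) (+) (x == (enum_val i).2))%:R)%R).
    under eq_bigr do rewrite -F2_natb_add.
    have [ai _] := edgeP i.
    have sum1 y : y \in nonisolated ->
        (\sum_(x in nonisolated) (x == y)%:R = 1 :> 'F_2)%R.
      move=> yV; rewrite (bigD1 y) //= eqxx big1 ?addr0 //.
      by move=> x /andP[_ /negbTE->].
    have i1 := a_noniso _ _ ai; rewrite sym_a in ai; have i2 := a_noniso _ _ ai.
    by rewrite big_split /= !sum1 ?F2_addxx.
  have := mulmx0_rank_max M1.
  suff: 0 < \rank (const_mx 1 : 'cV['F_2]_nV)%R by lia.
  rewrite lt0n mxrank_eq0; apply/eqP => /matrixP.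
  have j0 : 'I_nV := enum_rank_in (a_noniso _ _ a0) x0.
  by move/(_ j0 0%R); rewrite !mxE.
(* A row vector killed by [M] is a cycle, and the second clause of the dual makes it a combination
   of rows of [D]. *)
have ker_D : (kermx M <= D)%MS.
  apply/row_subP => i0; set u := row i0 _.
  have uM : (u *m M = 0)%R by apply: (sub_kermxP _); apply: row_sub.
  (* Edges are enumerated in one orientation only; [z] turns the vector into a symmetric
     function. *)
  pose uf p := (\sum_(i < nE) u 0 i * (enum_val i == p)%:R)%R.
  pose z x y := (uf (x, y) + uf (y, x))%R.
  have z_sym x y : z x y = z y x by rewrite /z addrC.
  have z_off x y : ~~ a x y -> z x y = 0%R.
    move=> nxy; rewrite /z /uf !big1 ?addr0 // => i _.
      have [ai _] := edgeP i; case: eqP => [ei|]; last by rewrite mulr0.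
      by rewrite ei /= sym_a (negbTE nxy) in ai.
    have [ai _] := edgeP i; case: eqP => [ei|]; last by rewrite mulr0.
    by rewrite ei /= (negbTE nxy) in ai.
  have z_sum x : (\sum_y z x y = 0)%R.
    have -> : (\sum_y z x y = \sum_(i < nE) u 0 i *
        ((x == (enum_val i).1) (+) (x == (enum_val i).2))%:R)%R.
      rewrite /z big_split /= /uf exchange_big [X in (_ + X)%R]exchange_big /=.
      rewrite -big_split /=; apply: eq_bigr => i _; rewrite -!mulr_sumr -mulrDr.
      congr (_ * _)%R; rewrite -F2_natb_add; congr (_ + _)%R.
        rewrite (bigD1 (enum_val i).2) //= big1 ?addr0 => [|y ny]; rewrite pairE.
          by rewrite eqxx andbT eq_sym.
        by rewrite [_ == y]eq_sym (negbTE ny) andbF.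
      rewrite (bigD1 (enum_val i).1) //= big1 ?addr0 => [|y ny]; rewrite pairE.
        by rewrite eqxx eq_sym.
      by rewrite [_ == y]eq_sym (negbTE ny).
    have [xV|xV] := boolP (x \in nonisolated).
      move/matrixP/(_ 0%R (enum_rank_in xV x)): uM; rewrite !mxE => uM.
      rewrite -[RHS]uM; apply: eq_bigr => i _; rewrite !mxE.
      by rewrite enum_rankK_in.
    rewrite big1 // => i _; have [ai _] := edgeP i.
    have /negbTE-> : x != (enum_val i).1.
      by apply: contraNneq xV => ->; apply: a_noniso ai.
    have /negbTE-> : x != (enum_val i).2.
      by rewrite sym_a in ai; apply: contraNneq xV => ->; apply: a_noniso ai.
    by rewrite mulr0.
  have [chi chiP] := dual.2 z z_sym z_off z_sum.
  suff -> : u = ((\row_k chi (enum_val k)) *m D)%R by apply: submxMl.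
  apply/matrixP=> i1 i; rewrite ord1 {i1} [RHS]mxE.
  have [ai lti] := edgeP i; set x := (enum_val i).1; set y := (enum_val i).2.
  have uz : u 0%R i = z x y.
    rewrite /z /uf (bigD1 i) //= -surjective_pairing eqxx mulr1 big1 ?addr0.
      rewrite big1 ?addr0 // => j _; case: eqP => [ej|]; last by rewrite mulr0.
      have [_] := edgeP j; rewrite ej /= => ltj.
      by have := ltn_trans lti ltj; rewrite ltnn.
    by move=> j ji; rewrite (inj_eq enum_val_inj) (negbTE ji) mulr0.
  rewrite uz chiP //.
  under eq_bigr do rewrite !mxE.
  transitivity (\sum_(f in proper_faces) chi f * (boundary f x y)%:R)%R; last first.
    by rewrite big_enum_val.
  transitivity (\sum_f chi f * (boundary f x y)%:R)%R; last first.
    rewrite [RHS]big_mkcond; apply: eq_bigr => f _; case: ifPn => // nf.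
    case bf: (boundary f x y); last by rewrite mulr0.
    by case/negP: nf; rewrite inE; apply/existsP; exists x; apply/existsP; exists y.
  under eq_bigr do rewrite /boundary /= ai /= -F2_natb_add mulrDr.
  rewrite big_split /= (bigD1 (face x y)) //= eqxx mulr1 big1 ?addr0; last first.
    by move=> f; rewrite eq_sym => /negbTE->; rewrite mulr0.
  congr (_ + _)%R.
  rewrite (bigD1 (face y x)) //= eqxx mulr1 big1 ?addr0 //.
  by move=> f; rewrite eq_sym => /negbTE->; rewrite mulr0.
(* [nE - \rank M <= \rank D <= nF], combined with [\rank M < nV]. *)
have := mxrankS ker_D; rewrite mxrank_ker => rk.
have := rank_leq_row D; rewrite -/nE -/nV -/nF; lia.
Qed.

End Dual.

(** * Discharging *)

Lemma card_sum_bool (T : finType) (Q : pred T) : #|Q| = \sum_y (Q y : nat).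
Proof.
rewrite -sum1_card big_mkcond; apply: eq_bigr => y _.
by rewrite unfold_in; case: (Q y).
Qed.

Section Discharging.

Variables (V F : finType) (a : rel V) (face : V -> V -> F).
Hypotheses (sym_a : symmetric a) (irr_a : irreflexive a).
Hypothesis dual : abstract_dual a face.

Local Notation d := (rdeg a).
Local Notation bd := (boundary a face).

Hypothesis deg_ge3 : forall x y, a x y -> 2 < d x.
Hypothesis heavy : forall x y, a x y -> d x <= 5 -> 14 <= d x + d y.

(* Initial charges are [d x - 6] at a vertex, [2 l - 6] at a face of length [l]
   and [4] at a bridge; all of them are doubled below.  A small vertex takes 1
   (if its degree is 3) or 1/2 along every edge, a bridge gives 2 to each end,
   and a face gives [gift] to a vertex: half the excess of its boundary edges
   there that lead to small vertices over those that do not. *)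
Let small : pred V := [pred x | d x <= 5].
Let demand x := if d x == 3 then 2 else if d x <= 5 then 1 else 0.
Let sdeg (b : rel V) x := #|[pred y | b x y && small y]|.
Let bdeg (b : rel V) x := #|[pred y | b x y && ~~ small y]|.
Let gift f x := (sdeg (bd f) x - bdeg (bd f) x)./2.
Let bridges x := #|[pred y | a x y && (face x y == face y x)]|.

Let rdeg_split (b : rel V) x : rdeg b x = sdeg b x + bdeg b x.
Proof.
rewrite /rdeg /sdeg /bdeg -(cardID small [pred y | b x y]).
by congr (_ + _); apply: eq_card => y; rewrite !inE // andbC.
Qed.

(** Since [14 - 5 = 9], no two small vertices are adjacent. *)
Let nbr_big x y : a x y -> d x <= 5 -> 8 < d y.
Proof. by move=> axy dx; have := heavy axy dx; lia. Qed.

Let bd_sub f : subrel (bd f) a.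
Proof. by move=> x y /andP[]. Qed.

Let count_faces x y : a x y ->
  \sum_f (bd f x y : nat) = if face x y == face y x then 0 else 2.
Proof.
move=> axy; rewrite /boundary /=; under eq_bigr do rewrite axy /=.
case: eqP => [->|/eqP ne]; first by rewrite big1 // => f _; rewrite addbb.
rewrite (bigD1 (face x y)) //= (bigD1 (face y x)) /=; last by rewrite eq_sym.
rewrite !eqxx (negbTE ne) eq_sym (negbTE ne) big1 // => f /andP[].
by rewrite ![f == _]eq_sym => /negbTE-> /negbTE->.
Qed.

Let sum_faces_bd (P : pred V) x :
  \sum_f #|[pred y | bd f x y && P y]| =
  2 * #|[pred y | [&& a x y, P y & face x y != face y x]]|.
Proof.
under eq_bigr do rewrite card_sum_bool.
rewrite exchange_big card_sum_bool big_distrr /=; apply: eq_bigr => y _.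
case axy: (a x y) => /=; last by rewrite big1 // => f _; rewrite /boundary /= axy.
case Py: (P y) => /=; last by rewrite big1 // => f _; rewrite andbF.
under eq_bigr do rewrite andbT.
by rewrite count_faces //; case: eqP.
Qed.

(** Boundary degrees are even, so the halving in [gift] loses nothing. Summed over the faces, every
    edge at [x] counts twice, except the bridges, which are added separately. *)
Let sdeg_bound x : sdeg a x <= bdeg a x + \sum_f gift f x + bridges x.
Proof.
have gf f : sdeg (bd f) x <= bdeg (bd f) x + 2 * gift f x.
  have := boundary_even dual f x; rewrite rdeg_split /gift.
  by move: (sdeg _ _) (bdeg _ _); lia.
have: \sum_f sdeg (bd f) x <= \sum_f (bdeg (bd f) x + 2 * gift f x).
  by apply: leq_sum => f _.
rewrite big_split -big_distrr /= !sum_faces_bd.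
have -> : sdeg a x = #|[pred y | [&& a x y, small y & face x y != face y x]]| +
   #|[pred y | [&& a x y, small y & face x y == face y x]]|.
  rewrite /sdeg -(cardID [pred y | face x y != face y x]) /=; congr (_ + _);
    apply: eq_card => y; rewrite !inE /=; by case: (a x y); case: (small y); case: (face x y == face y x).
have le1 : #|[pred y | [&& a x y, small y & face x y == face y x]]| <= bridges x.
  by apply: subset_leq_card; apply/subsetP=> y; rewrite !inE => /and3P[-> _ ->].
have le2 : #|[pred y | [&& a x y, ~~ small y & face x y != face y x]]| <= bdeg a x.
  by apply: subset_leq_card; apply/subsetP=> y; rewrite !inE => /and3P[-> -> _].
move: (#|_|) (#|_|) (#|_|) le1 le2 => n1 n2 n3.
by move: (bridges x) (bdeg a x) (\sum_f _); lia.
Qed.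

Let demand_big x : 5 < d x -> demand x = 0.
Proof. by rewrite /demand; case: eqP => [->//|_]; rewrite ltnNge => /negbTE->. Qed.

(** This is nonnegativity of the doubled final charge. Degrees 3 to 5 are saved by what they take,
    degrees 6 to 8 have no small neighbour, and from degree 9 on [sdeg_bound] balances the
    demands. *)
Let vertex_charge x : 0 < d x ->
  \sum_(y | a x y) demand y + 12 <=
  2 * d x + d x * demand x + 2 * (\sum_f gift f x) + 4 * bridges x.
Proof.
move=> dx0; have /card_gt0P[y0] := dx0; rewrite inE => axy0.
have dx3 := deg_ge3 axy0.
have [dx5|dx5] := leqP (d x) 5.
  rewrite big1 => [|y axy]; last first.
    by apply: demand_big; apply: leq_trans (nbr_big axy dx5).
  rewrite /demand; move: (\sum_f _) (bridges x) (d x) dx3 dx5 => g b e e3 e5.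
  have: e = 3 \/ e = 4 \/ e = 5 by lia.
  by case=> [->|[->|->]] /=; lia.
rewrite (demand_big dx5).
have dem c : (forall y, a x y -> small y -> demand y <= c) ->
    \sum_(y | a x y) demand y <= c * sdeg a x.
  move=> le_c; rewrite (bigID small) /= [X in _ + X]big1 ?addn0 => [|y /andP[_]].
    rewrite /sdeg -sum1_card big_distrr /= muln1.
    by apply: leq_sum => y /andP[axy sy]; apply: le_c.
  by rewrite -ltnNge => /demand_big.
have sb := sdeg_bound x; have dE := rdeg_split a x.
have le2 : \sum_(y | a x y) demand y <= 2 * sdeg a x.
  by apply: dem => y _ _; rewrite /demand; case: ifP => //; case: ifP.
(* A neighbour of degree 3 would force [d x >= 11], so here no neighbour demands 2. *)
have le1 : d x <= 10 -> \sum_(y | a x y) demand y <= 1 * sdeg a x.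
  move=> dx10; apply: dem => y axy sy; rewrite /demand.
  rewrite sym_a in axy; have := heavy axy sy.
  by case: eqP => [->|_ _]; [lia | case: ifP].
have le0 : d x <= 8 -> \sum_(y | a x y) demand y <= 0 * sdeg a x.
  move=> dx8; apply: dem => y axy sy.
  by rewrite sym_a in axy; have := nbr_big axy sy; lia.
(* From degree 11 on, [s + t >= 11] and [s <= t + g + b] give [t + g + b >= 6]: either [s >= 6] or
   [t >= 6]. This pays the 12. *)
move: (\sum_(y | _) _) (\sum_f _) (bridges x) (d x) (sdeg a x) (bdeg a x) dx5 dE sb le2 le1 le0.
by clear; move=> c g b e s t; lia.
Qed.

(** Let the boundary have [l] edges. Each has at most one small end, so the gifts total at most
    [l / 2]. If some gift is positive then [l >= 4] and [4 l - 12 >= l]; otherwise [l >= 3]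
    suffices. *)
Let face_charge f : f \in proper_faces a face ->
  2 * (\sum_x gift f x) + 12 <= 2 * (\sum_x rdeg (bd f) x).
Proof.
rewrite inE => /existsP[x0 /existsP[y0 b0]].
have len3 := boundary_length_ge3 sym_a irr_a dual b0.
have sum_s : 2 * (\sum_x sdeg (bd f) x) <= \sum_x rdeg (bd f) x.
  have e1 : \sum_x sdeg (bd f) x = \sum_x \sum_y (bd f x y && small y : nat).
    by apply: eq_bigr => x _; rewrite /sdeg card_sum_bool.
  have e2 : \sum_x sdeg (bd f) x = \sum_x \sum_y (bd f x y && small x : nat).
    rewrite e1 exchange_big; apply: eq_bigr => x _; apply: eq_bigr => y _.
    by rewrite (boundary_sym face sym_a).
  rewrite mul2n -addnn {1}e1 e2 -big_split; apply: leq_sum => x _.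
  rewrite -big_split /rdeg card_sum_bool; apply: leq_sum => y _ /=.
  case bxy: (bd f x y) => //=; have axy := bd_sub bxy.
  case sx: (small x); case sy: (small y) => //.
  by have := nbr_big axy sx; rewrite ltnNge (leq_trans sy).
have sum_g : 2 * (\sum_x gift f x) <= \sum_x sdeg (bd f) x.
  rewrite big_distrr; apply: leq_sum => v _; rewrite /gift /=.
  by move: (sdeg _ _) (bdeg _ _); lia.
case: (pickP [pred x | 0 < gift f x]) => [x /= gx|g0]; last first.
  rewrite [X in 2 * X + _]big1; last by move=> x _; have := g0 x => /=; lia.
  by move: (\sum_v rdeg (bd f) v) len3; lia.
suff: 8 <= \sum_x rdeg (bd f) x.
  by move: (\sum_v rdeg (bd f) v) (\sum_v gift f v) (\sum_v sdeg (bd f) v) sum_g sum_s; lia.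
(* A positive gift at [x] needs two small boundary neighbours. Their next neighbours [z1] and [z2]
   are big, so the boundary is not a triangle and has at least four edges. *)
have /card_gt1P[y1 [y2 []]] : 1 < sdeg (bd f) x.
  by move: gx; rewrite /gift; move: (sdeg _ _) (bdeg _ _); lia.
rewrite !inE => /andP[b1 s1] /andP[b2 s2] y12.
have b1' : bd f y1 x by rewrite (boundary_sym face sym_a).
have b2' : bd f y2 x by rewrite (boundary_sym face sym_a).
have [z1 c1 z1x] := boundary_next dual b1'; have [z2 c2 z2x] := boundary_next dual b2'.
have c1' : bd f z1 y1 by rewrite (boundary_sym face sym_a).
have c2' : bd f z2 y2 by rewrite (boundary_sym face sym_a).
have big1 := nbr_big (bd_sub c1) s1; have big2 := nbr_big (bd_sub c2) s2.
have n1 := boundary_neq irr_a b1; have n2 := boundary_neq irr_a b2.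
have n3 : z1 != y1 by apply: contraTneq big1 => ->; rewrite -leqNgt (leq_trans s1).
have n4 : z1 != y2 by apply: contraTneq big1 => ->; rewrite -leqNgt (leq_trans s2).
have n5 : z2 != y1 by apply: contraTneq big2 => ->; rewrite -leqNgt (leq_trans s1).
have n6 : z2 != y2 by apply: contraTneq big2 => ->; rewrite -leqNgt (leq_trans s2).
apply: (@sum_rdeg_ge _ _ [:: (x, y1); (y1, x); (x, y2); (y2, x);
                           (y1, z1); (z1, y1); (y2, z2); (z2, y2)]).
  by neq_uniq.
by rewrite /= b1 b1' b2 b2' c1 c1' c2 c2'.
Qed.

(** Gifts, demands and bridge payments cancel in the total. The doubled initial charge is
    [12 * (E - V - F)], negative by Euler's inequality, although no final charge is negative. *)
Lemma heavy_graph_empty x y : ~~ a x y.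
Proof.
apply/negP=> axy.
have euler := euler_inequality sym_a dual (ex_intro _ x (ex_intro _ y axy)).
have edges2 := sum_rdeg_edges sym_a irr_a.
have d0 u : u \notin nonisolated a -> d u = 0 by rewrite inE -eqn0Ngt => /eqP.
have vsum : \sum_u \sum_(v | a u v) demand v + 12 * #|nonisolated a| <=
    2 * (\sum_u d u) + \sum_u d u * demand u + 2 * (\sum_u \sum_f gift f u)
    + 4 * (\sum_u bridges u).
  rewrite !big_distrr /= -!big_split /= -sum1_card big_distrr /= [X in _ + X]big_mkcond.
  rewrite -big_split; apply: leq_sum => u _; case: ifP => [|/negbT /d0 du0].
    by rewrite inE => /vertex_charge; rewrite muln1.
  rewrite big_pred0 // => v; apply/negP=> auv.
  by move/card0_eq/(_ v): du0; rewrite !inE auv.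
have demE : \sum_u \sum_(v | a u v) demand v = \sum_u d u * demand u.
  rewrite (exchange_big_dep xpredT) //=; apply: eq_bigr => u _.
  by rewrite sum_nat_const; congr (_ * _); apply: eq_card => v; rewrite !inE sym_a.
have fsum : 2 * (\sum_f \sum_u gift f u) + 12 * #|proper_faces a face| <=
    2 * (\sum_f \sum_u rdeg (bd f) u).
  rewrite !big_distrr /= -sum1_card big_distrr /= [X in _ + X]big_mkcond.
  rewrite -big_split; apply: leq_sum => f _; case: ifP => [/face_charge|nf].
    by rewrite muln1.
  rewrite /= addn0 leq_mul2l /=; apply: leq_sum => u _.
  rewrite /gift rdeg_split; move: (sdeg _ _) (bdeg _ _); lia.
have bsum : \sum_f \sum_u rdeg (bd f) u + 2 * (\sum_u bridges u) = 2 * \sum_u d u.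
  rewrite exchange_big /= !big_distrr /= -big_split; apply: eq_bigr => u _ /=.
  have -> : \sum_f rdeg (bd f) u = \sum_f #|[pred v | bd f u v && predT v]|.
    by apply: eq_bigr => f _; apply: eq_card => v; rewrite !inE andbT.
  rewrite sum_faces_bd -mulnDr; congr (2 * _).
  rewrite /rdeg -[RHS](cardID [pred v | face u v != face v u]); congr (_ + _);
    apply: eq_card => v; rewrite !inE /=; by case: (a u v); case: (face u v == face v u).
have giftE : \sum_u \sum_f gift f u = \sum_f \sum_u gift f u by exact: exchange_big.
move: vsum fsum; rewrite demE giftE.
move: (\sum_u d u * demand u) (\sum_f \sum_u gift f u)
  (\sum_f \sum_u rdeg (bd f) u) (\sum_u d u)
  (\sum_u bridges u) (#|_|) (#|_|) (#|_|) edges2 bsum euler.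
by clear; lia.
Qed.

End Discharging.

(** If every edge failed, all its ends would have degree at least 3 and it would be heavy,
    contradicting [heavy_graph_empty]. *)
Lemma light_edge_exists (V F : finType) (a : rel V) (face : V -> V -> F) :
  symmetric a -> irreflexive a -> abstract_dual a face -> (exists x y, a x y) ->
  exists x y, a x y /\ (rdeg a x <= 2 \/ rdeg a x <= 5 /\ rdeg a x + rdeg a y <= 13).
Proof.
move=> sym_a irr_a dual [x0 [y0 a0]].
pose light := [pred p : V * V | a p.1 p.2 &&
  ((rdeg a p.1 <= 2) || (rdeg a p.1 <= 5) && (rdeg a p.1 + rdeg a p.2 <= 13))].
case: (pickP light) => [[x y] /= /andP[axy le]|none].
  exists x, y; split=> //; case/orP: le => [|/andP[]]; first by left.
  by right.
suff: ~~ a x0 y0 by rewrite a0.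
apply: (heavy_graph_empty sym_a irr_a dual) => x y axy; have := none (x, y);
  rewrite /= axy /=; move: (rdeg a x) (rdeg a y); lia.
Qed.

(** * Minors of the grid have abstract duals *)

From mathcomp Require Import boolp.

Definition adj4 (p q : nat * nat) : bool :=
  (p.1 == q.1) && ((q.2 == p.2.+1) || (p.2 == q.2.+1)) ||
  (p.2 == q.2) && ((q.1 == p.1.+1) || (p.1 == q.1.+1)).

(** Predecessors truncate at 0, so these are the four lattice neighbours only at a point with
    positive coordinates. *)
Definition nbrs (p : nat * nat) : seq (nat * nat) :=
  [:: (p.1.+1, p.2); (p.1, p.2.+1); (p.1.-1, p.2); (p.1, p.2.-1)].

(* The cell [(i, j)] is the unit square with lower left corner [(i, j)]. *)
Definition left_cell (p q : nat * nat) : nat * nat :=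
  if p.1 < q.1 then p else if q.1 < p.1 then (q.1, p.2.-1)
  else if p.2 < q.2 then (p.1.-1, p.2) else q.

Definition positive_pt (p : nat * nat) := (0 < p.1) && (0 < p.2).

Lemma adj4_sym : symmetric adj4.
Proof.
move=> p q; rewrite /adj4 eq_sym [p.2 == q.2]eq_sym.
by rewrite [(q.2 == _) || _]orbC [(q.1 == _) || _]orbC.
Qed.

Lemma mem_nbrs p q : positive_pt p -> (q \in nbrs p) = adj4 p q.
Proof.
case: p q => [i j] [k l] /andP[/= i0 j0]; rewrite /adj4 !inE !xpair_eqE /=; lia.
Qed.

Lemma uniq_nbrs p : positive_pt p -> uniq (nbrs p).
Proof.
by case: p => i j /andP[/= i0 j0]; rewrite /nbrs /= !inE !xpair_eqE /=; lia.
Qed.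

(** * Cycles and cell functions of the grid over F_2 *)

Section F2Grid.
Local Open Scope ring_scope.

Lemma F2_cases (x : 'F_2) : x = 0 \/ x = 1.
Proof. by case: x => -[|[|n]] ltn //; [left | right]; apply: val_inj. Qed.

Lemma F2_add_eq0 (x y : 'F_2) : x + y = 0 -> x = y.
Proof.
move/eqP; rewrite addr_eq0 => /eqP->.
by rewrite -[LHS]addr0 -(F2_addxx y) addrA addNr add0r.
Qed.

(** Each of the four cells around [p] borders two of the four steps at [p], so its value occurs
    twice. *)
Lemma left_cell_nbrs_sum (g : nat * nat -> 'F_2) p : positive_pt p ->
  \sum_(q <- nbrs p) (g (left_cell p q) + g (left_cell q p)) = 0.
Proof.
case: p => -[|i] [|j] // _.
rewrite !big_cons big_nil /left_cell /= !ltnSn !ltnn.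
rewrite (_ : (i.+2 < i.+1)%N = false); last lia.
rewrite (_ : (j.+2 < j.+1)%N = false); last lia.
rewrite (_ : (i.+1 < i)%N = false); last lia.
rewrite (_ : (j.+1 < j)%N = false) /=; last lia.
move: (g _) (g _) (g _) (g _) => A B C D.
by apply/eqP; case: (F2_cases A) => ->; case: (F2_cases B) => ->;
  case: (F2_cases C) => ->; case: (F2_cases D) => ->.
Qed.

Lemma sum_nbrs_step p q x : positive_pt p -> adj4 p q ->
  \sum_(y <- nbrs x) ((x, y) == (p, q))%:R = (x == p)%:R :> 'F_2.
Proof.
move=> p0 pq; have [->|xp] := eqVneq x p; last first.
  by rewrite big1 // => y _; rewrite xpair_eqE (negbTE xp).
rewrite (bigD1_seq q) ?mem_nbrs ?uniq_nbrs //= eqxx big1 ?addr0 //.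
by move=> y /negbTE yq; rewrite xpair_eqE yq andbF.
Qed.

(** [t] is the sum mod 2 of the edges of the walk; the boundaries telescope to its two ends. *)
Lemma path_chain (A : pred (nat * nat)) p s :
  (forall q, A q -> positive_pt q) -> path adj4 p s -> all A (p :: s) ->
  exists t : nat * nat -> nat * nat -> 'F_2,
  [/\ forall x y, t x y = t y x, forall x y, ~~ (A x && A y) -> t x y = 0
    & forall x, \sum_(y <- nbrs x) t x y = (x == p)%:R + (x == last p s)%:R].
Proof.
move=> posA; elim: s p => [|q s IHs] p /=.
  move=> _ _; exists (fun _ _ => 0); split=> // x.
  by rewrite big1 // F2_addxx.
case/andP=> pq qs /and3P[Ap Aq As]; have [|t [t_sym t0 t_bd]] := IHs q qs.
  by rewrite /= Aq.
exists (fun x y => ((x, y) == (p, q))%:R + ((x, y) == (q, p))%:R + t x y); split.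
- move=> x y; rewrite t_sym; congr (_ + _); rewrite addrC !xpair_eqE.
  by rewrite [(x == q) && _]andbC [(x == p) && _]andbC.
- move=> x y; have [->|/negbTE xp] := eqVneq x p.
    have [->|/negbTE yq nA] := eqVneq y q; first by rewrite Ap Aq.
    rewrite !xpair_eqE yq andbF add0r t0 // addr0; case: eqP => //= pq0.
    by case: eqP => // yp; rewrite pq0 yp Aq Ap in nA *; rewrite -pq0 yp eqxx in yq.
  rewrite !xpair_eqE xp /= add0r => nA; rewrite t0 // addr0.
  by case: eqP => //= xq; case: eqP => // yp; rewrite xq yp Ap Aq in nA.
- move=> x; rewrite !big_split /= t_bd !sum_nbrs_step ?posA // 1?adj4_sym //.
  by rewrite -addrA [X in _ + X]addrA F2_addxx add0r.
Qed.

(** [g] counts mod 2 the edges of [w] met by the ray running left from a cell. Crossing a vertical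
    edge changes it by construction; for a horizontal edge, induct along the row, using that [w] is
    even at every positive point. *)
Lemma grid_potential (w : nat * nat -> nat * nat -> 'F_2) :
  (forall p q, w p q = w q p) ->
  (forall p q, ~~ positive_pt p -> w p q = 0) ->
  (forall p, positive_pt p -> \sum_(q <- nbrs p) w p q = 0) ->
  exists g : nat * nat -> 'F_2, forall p q, positive_pt p -> adj4 p q ->
    w p q = g (left_cell p q) + g (left_cell q p).
Proof.
move=> w_sym w0 w_bd.
pose g (c : nat * nat) := \sum_(k < c.1.+1) w (nat_of_ord k, c.2) (nat_of_ord k, c.2.+1).
have gV i j : g (i, j) + g (i.+1, j) = w (i.+1, j) (i.+1, j.+1).
  by rewrite {2}/g big_ord_recr /= addrA F2_addxx add0r.
have gH i j : g (i, j) + g (i, j.+1) = w (i, j.+1) (i.+1, j.+1).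
  elim: i => [|i IHi].
    by rewrite /g !big_ord_recl !big_ord0 /= !w0 ?addr0.
  rewrite {1 2}/g big_ord_recr [X in _ + X]big_ord_recr /= addrACA.
  rewrite -[\sum_(_ < _) _]/(g (i, j)) -[\sum_(k < _) w (_, j.+1) _]/(g (i, j.+1)) IHi.
  have := w_bd (i.+1, j.+1) isT; rewrite !big_cons big_nil /= addr0.
  rewrite [w (i.+1, j.+1) (i, _)]w_sym [w (i.+1, j.+1) (_, j)]w_sym => bd0.
  move: bd0; move: (w (i.+1, j.+1) (i.+2, j.+1)) (w (i.+1, j.+1) (i.+1, j.+2))
    (w (i, j.+1) (i.+1, j.+1)) (w (i.+1, j) (i.+1, j.+1)) => A B C D /eqP bd0.
  by apply/eqP; move: bd0; case: (F2_cases A) => ->; case: (F2_cases B) => ->;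
    case: (F2_cases C) => ->; case: (F2_cases D) => ->.
exists g => -[i j] [k l] /andP[/= i0 j0]; rewrite /adj4 /= => /orP[] /andP[/eqP].
  move=> <-; case/orP=> /eqP ->; rewrite /left_cell /= !ltnn.
    by rewrite ltnSn ltnNge leqnSn /=; case: i i0 => // i _; rewrite gV.
  rewrite [in X in _ = X](_ : (l.+1 < l)%N = false); last lia.
  rewrite ltnSn /= w_sym; case: i i0 => // i _; by rewrite addrC gV.
move=> <-; case/orP=> /eqP ->; rewrite /left_cell /= ltnSn ltnNge leqnSn /=.
  by case: j j0 => // j _ /=; rewrite addrC gH.
by case: j j0 => // j _ /=; rewrite w_sym gH.
Qed.

Lemma F2_sym_sum (T : Type) (h : T -> T -> 'F_2) (r : seq T) :
  (forall x y, h x y = h y x) -> (forall x, h x x = 0) ->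
  \sum_(x <- r) \sum_(y <- r) h x y = 0.
Proof.
move=> h_sym h0; elim: r => [|x r IHr]; first by rewrite big_nil.
rewrite !big_cons h0 add0r; under [X in _ + X]eq_bigr do rewrite big_cons.
rewrite big_split /= IHr addr0.
by under eq_bigr do rewrite h_sym; rewrite F2_addxx.
Qed.

End F2Grid.

(* The graph is a minor of a finite grid: [lam] assigns lattice points to
   pairwise disjoint branch sets, each connected through its root [c v]. *)
Definition grid_model (V : finType) (a : rel V) (m : nat)
    (lam : nat * nat -> option V) (c : V -> nat * nat) :=
  [/\ forall p v, lam p = Some v -> [&& 0 < p.1, 0 < p.2, p.1 <= m & p.2 <= m],
      forall p v, lam p = Some v -> exists s,
        [/\ path adj4 (c v) s, last (c v) s = p
          & all (fun q => lam q == Some v) (c v :: s)]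
    & forall u v, a u v ->
        exists p q, [/\ adj4 p q, lam p = Some u & lam q = Some v]].

Lemma grid_model_sub (V : finType) (a b : rel V) m lam c :
  subrel b a -> grid_model a m lam c -> grid_model b m lam c.
Proof. by move=> ba [h1 h2 h3]; split=> // u v /ba; apply: h3. Qed.

(** * Faces of a grid minor *)

Section GridDual.

Variables (V : finType) (a : rel V) (m : nat).
Variables (lam : nat * nat -> option V) (c : V -> nat * nat).
Hypotheses (sym_a : symmetric a) (irr_a : irreflexive a).
Hypothesis model : grid_model a m lam c.

Local Notation pt := (nat * nat)%type.

Let lam_pos p v : lam p = Some v -> positive_pt p.
Proof. by case: model => h _ _ /h/and4P[p1 p2 _ _]; rewrite /positive_pt p1. Qed.

(** The grid edge is chosen for one orientation, fixed by the ranks, and reversed for the other;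
    separate choices could disagree. *)
Lemma crossing_exists : exists kappa : V -> V -> pt * pt,
  (forall u v, a u v -> [/\ adj4 (kappa u v).1 (kappa u v).2,
     lam (kappa u v).1 = Some u & lam (kappa u v).2 = Some v]) /\
  (forall u v, a u v -> kappa v u = ((kappa u v).2, (kappa u v).1)).
Proof.
have /choice[k kP] : forall uv : V * V, exists pq : pt * pt, a uv.1 uv.2 ->
    [/\ adj4 pq.1 pq.2, lam pq.1 = Some uv.1 & lam pq.2 = Some uv.2].
  move=> [u v] /=; case auv: (a u v); last by exists ((0, 0), (0, 0)).
  by case: model => _ _ /(_ u v auv)[p [q [h1 h2 h3]]]; exists (p, q).
exists (fun u v => if enum_rank u < enum_rank v then k (u, v)
                   else ((k (v, u)).2, (k (v, u)).1)); split=> u v auv.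
  case: ifP => _; first exact: (kP (u, v)).
  have avu : a v u by rewrite sym_a.
  by have [h1 h2 h3] := kP (v, u) avu; rewrite adj4_sym.
have: enum_rank u != enum_rank v :> nat.
  rewrite (inj_eq val_inj) (inj_eq enum_rank_inj).
  by apply: contraTneq auv => ->; rewrite irr_a.
by case: (ltngtP (enum_rank u) (enum_rank v)) => //= _ _; case: (k (v, u)).
Qed.

Variable kappa : V -> V -> pt * pt.
Hypothesis kappaP : forall u v, a u v -> [/\ adj4 (kappa u v).1 (kappa u v).2,
  lam (kappa u v).1 = Some u & lam (kappa u v).2 = Some v].
Hypothesis kappaC : forall u v, a u v -> kappa v u = ((kappa u v).2, (kappa u v).1).

Local Notation cell := ('I_m.+1 * 'I_m.+1)%type.

(** Steps at points of the model border only cells with coordinates at most [m], which [inord]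
    leaves unchanged. *)
Definition step_cell (p q : pt) : cell :=
  (inord (left_cell p q).1, inord (left_cell p q).2).

(** The grid edges that leave a branch set and are not chosen crossings: they disappear in the
    minor, which merges the cells beside them. *)
Definition deleted_step (p q : pt) :=
  [/\ adj4 p q, lam p <> None, lam q <> lam p
    & forall u v, a u v -> kappa u v <> (p, q)].

Definition constant_across_deleted (g : {ffun cell -> 'F_2}) :=
  forall p q, deleted_step p q -> g (step_cell p q) = g (step_cell q p).

(* The face of a cell is its evaluation functional: two cells lie in the same
   face iff no admissible function separates them. *)
Definition cell_face (d : cell) : {ffun {ffun cell -> 'F_2} -> 'F_2} :=
  [ffun g => if `[< constant_across_deleted g >] then g d else 0%R].

Definition grid_face (u v : V) := cell_face (step_cell (kappa u v).1 (kappa u v).2).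

Let cell_face_deleted p q : deleted_step p q ->
  cell_face (step_cell p q) = cell_face (step_cell q p).
Proof.
by move=> del; apply/ffunP => g; rewrite !ffunE; case: asboolP => // /(_ _ _ del).
Qed.

Let face_flip u v : a u v ->
  grid_face v u = cell_face (step_cell (kappa u v).2 (kappa u v).1).
Proof. by move=> auv; rewrite /grid_face kappaC. Qed.

Let points : seq pt := [seq (i, j) | i <- iota 1 m, j <- iota 1 m].

Let points_uniq : uniq points.
Proof. by apply: allpairs_uniq; rewrite ?iota_uniq // => -[? ?] [? ?]. Qed.

Let lam_points p v : lam p = Some v -> p \in points.
Proof.
case: model => h _ _ /h/and4P[p1 p2 p3 p4]; apply/allpairsP; exists p.
by split; rewrite ?mem_iota ?p1 ?p2 /= ?add1n ?ltnS //; case: p {p1 p2 p3 p4}.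
Qed.

Let kappa_inj u v u' v' : a u v -> a u' v' -> kappa u v = kappa u' v' -> (u, v) = (u', v').
Proof.
move=> auv auv' eqk; have [_ h1 h2] := kappaP auv; have [_ h1' h2'] := kappaP auv'.
by rewrite eqk h1' in h1; rewrite eqk h2' in h2; case: h1 h2 => -> [->].
Qed.

Let a_neq u v : a u v -> u <> v.
Proof. by move=> auv uv; rewrite uv irr_a in auv. Qed.

Section F2.
Local Open Scope ring_scope.

(** Sum [J] over all steps at all points of the branch set of [x]: the total vanishes point by
    point. Steps inside the branch set cancel in pairs, deleted steps have the same face on both
    sides, and the crossings remain. *)
Lemma grid_face_cut (chi : {ffun {ffun cell -> 'F_2} -> 'F_2} -> 'F_2) x :
  \sum_(y | a x y) (chi (grid_face x y) + chi (grid_face y x)) = 0.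
Proof.
pose J p q := chi (cell_face (step_cell p q)) + chi (cell_face (step_cell q p)).
have JC p q : J p q = J q p by rewrite /J addrC.
pose A p := lam p == Some x.
have Apos p : A p -> positive_pt p by move/eqP/lam_pos.
have tot : \sum_(p <- points | A p) \sum_(q <- nbrs p) J p q = 0.
  apply: big1 => p Ap.
  exact: (left_cell_nbrs_sum (fun d => chi (cell_face (inord d.1, inord d.2))) (Apos p Ap)).
have inner : \sum_(p <- points | A p) \sum_(q <- nbrs p | A q) J p q = 0.
  pose h p q := if [&& A p, A q & adj4 p q] then J p q else 0.
  have hC p q : h p q = h q p by rewrite /h adj4_sym JC andbCA.
  have h0 p : h p p = 0.
    by rewrite /h /adj4 !eqxx /=; case: ifP => // /and3P[_ _]; lia.
  rewrite -[RHS](F2_sym_sum points hC h0) [LHS]big_mkcond; apply: eq_bigr => p _.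
  case: ifPn => Ap; last by rewrite big1 // => q _; rewrite /h (negbTE Ap).
  rewrite -[LHS]big_filter -[RHS]big_mkcond -[RHS]big_filter.
  apply: perm_big; apply: uniq_perm; rewrite ?filter_uniq ?uniq_nbrs ?Apos //.
  move=> q; rewrite !mem_filter mem_nbrs ?Apos // Ap /=.
  case Aq: (A q) => //=; case: (adj4 p q) => //=.
  by rewrite (lam_points (eqP Aq)).
have cross p q : A p -> ~~ A q -> adj4 p q ->
    J p q = \sum_(y | a x y) (kappa x y == (p, q))%:R * J p q.
  move=> Ap nAq pq; case: (pickP [pred y | a x y && (kappa x y == (p, q))]).
    move=> y /= /andP[axy ky]; rewrite (bigD1 y) //= ky mul1r big1 ?addr0 //.
    move=> y' /andP[axy' yy']; case: eqP => [ky'|]; last by rewrite mul0r.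
    have [yy] : (x, y) = (x, y') by apply: kappa_inj => //; rewrite (eqP ky) ky'.
    by rewrite yy eqxx in yy'.
  move=> none; rewrite big1 => [|y axy]; last first.
    by have := none y; rewrite /= axy /= => ->; rewrite mul0r.
  rewrite /J cell_face_deleted ?F2_addxx //; split=> //.
  - by rewrite (eqP Ap).
  - by rewrite (eqP Ap) => /eqP; apply/negP.
  - move=> u v auv kuv; have [_ ku _] := kappaP auv.
    move: ku; rewrite kuv /= (eqP Ap) => -[xu]; subst u.
    by have := none v; rewrite /= auv kuv eqxx.
have outer : \sum_(p <- points | A p) \sum_(q <- nbrs p | ~~ A q) J p q =
    \sum_(y | a x y) J (kappa x y).1 (kappa x y).2.
  transitivity (\sum_(p <- points | A p) \sum_(q <- nbrs p | ~~ A q)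
      \sum_(y | a x y) (kappa x y == (p, q))%:R * J p q).
    apply: eq_bigr => p Ap; rewrite big_seq_cond [RHS]big_seq_cond.
    apply: eq_bigr => q /andP[]; rewrite mem_nbrs ?Apos // => pq nAq.
    exact: cross.
  under eq_bigr do rewrite exchange_big /=.
  rewrite exchange_big /=; apply: eq_bigr => y axy.
  have [k1 k2 k3] := kappaP axy.
  have pairE (e : pt * pt) p q : (e == (p, q)) = (e.1 == p) && (e.2 == q) by case: e.
  rewrite big_mkcond (bigD1_seq (kappa x y).1) ?(lam_points k2) //=.
  rewrite {1}/A k2 eqxx [X in _ + X]big1 ?addr0 => [|p pk]; last first.
    case: ifP => // _; apply: big1 => q _.
    by rewrite pairE [_ == p]eq_sym (negbTE pk) mul0r.
  rewrite big_mkcond (bigD1_seq (kappa x y).2) ?uniq_nbrs ?(lam_pos k2) //=; last first.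
    by rewrite mem_nbrs ?(lam_pos k2).
  rewrite [A _]/A k3 [X in _ + X]big1 ?addr0 => [|q qk]; last first.
    by case: ifP => // _; rewrite pairE [_ == q]eq_sym (negbTE qk) andbF mul0r.
  rewrite pairE !eqxx mul1r ifT //.
  by apply: contraTneq axy => -[->]; rewrite irr_a.
transitivity (\sum_(y | a x y) J (kappa x y).1 (kappa x y).2).
  by apply: eq_bigr => y axy; rewrite (face_flip axy).
rewrite -outer -[LHS]add0r -[X in X + _]inner -big_split /= -[RHS]tot.
by apply: eq_bigr => p _; rewrite [RHS](bigID A).
Qed.

(** Lift [z] to the grid: an edge in [z] contributes its crossing and, in each of the two branch
    sets, a path from the root to it. The potential of the lift is constant across deleted steps,
    and [chi] evaluates a face at this potential. *)
Lemma grid_face_cycle (z : V -> V -> 'F_2) :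
  (forall x y, z x y = z y x) -> (forall x y, ~~ a x y -> z x y = 0) ->
  (forall x, \sum_y z x y = 0) ->
  exists chi : {ffun {ffun cell -> 'F_2} -> 'F_2} -> 'F_2,
    forall x y, a x y -> z x y = chi (grid_face x y) + chi (grid_face y x).
Proof.
move=> z_sym z_off z_sum.
have /choice[t tP] : forall uv : V * V, exists t : pt -> pt -> 'F_2,
    a uv.1 uv.2 ->
    [/\ forall p q, t p q = t q p,
        forall p q, ~~ ((lam p == Some uv.1) && (lam q == Some uv.1)) -> t p q = 0
      & forall p, \sum_(q <- nbrs p) t p q =
          (p == c uv.1)%:R + (p == (kappa uv.1 uv.2).1)%:R].
  move=> [u v] /=; case auv: (a u v); last by exists (fun _ _ => 0).
  have [_ ku _] := kappaP auv; case: model => _ conn _.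
  have [s [path_s last_s all_s]] := conn _ _ ku.
  have [|t [t1 t2 t3]] := @path_chain (fun q => lam q == Some u) (c u) s _ path_s all_s.
    by move=> q /eqP /lam_pos.
  by exists t => _; split=> //; rewrite -last_s.
pose w p q := \sum_u \sum_v z u v * ((kappa u v == (p, q))%:R + t (u, v) p q).
have pairE (e : pt * pt) p q : (e == (p, q)) = (e.1 == p) && (e.2 == q) by case: e.
have w_sym p q : w p q = w q p.
  rewrite /w; under eq_bigr do under eq_bigr do rewrite mulrDr.
  under [RHS]eq_bigr do under eq_bigr do rewrite mulrDr.
  under eq_bigr do rewrite big_split /=; under [RHS]eq_bigr do rewrite big_split /=.
  rewrite !big_split /=; congr (_ + _).
    rewrite exchange_big; apply: eq_bigr => u _; apply: eq_bigr => v _.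
    rewrite z_sym; case auv: (a u v); last by rewrite z_off ?auv // !mul0r.
    by rewrite kappaC // !pairE /= andbC.
  apply: eq_bigr => u _; apply: eq_bigr => v _.
  case auv: (a u v); last by rewrite z_off ?auv // !mul0r.
  by have [-> _ _] := tP (u, v) auv.
have w0 p q : ~~ positive_pt p -> w p q = 0.
  move=> np; rewrite /w big1 // => u _; rewrite big1 // => v _.
  case auv: (a u v); last by rewrite z_off ?auv // mul0r.
  have [_ -> //] := tP (u, v) auv; last first.
    by rewrite negb_and; apply/orP; left; apply: contraNN np => /eqP /lam_pos.
  rewrite addr0 pairE; case: eqP => [kp|]; last by rewrite mulr0.
  by have [_ ku _] := kappaP auv; rewrite -kp (lam_pos ku) in np.
(* The crossing cancels the far end of its path, so [(u, v)] leaves [z u v] at the root [c u]; these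
   add up to 0 over [v]. *)
have w_bd p : positive_pt p -> \sum_(q <- nbrs p) w p q = 0.
  move=> p0; rewrite /w exchange_big big1 //= => u _; rewrite exchange_big /=.
  transitivity (\sum_v z u v * (p == c u)%:R); last first.
    by rewrite -mulr_suml z_sum mul0r.
  apply: eq_bigr => v _; rewrite -mulr_sumr.
  case auv: (a u v); last by rewrite z_off ?auv // !mul0r.
  have [_ _ tb] := tP (u, v) auv; have [k1 k2 k3] := kappaP auv.
  rewrite big_split /= tb; congr (_ * _).
  under eq_bigr do rewrite eq_sym [kappa u v]surjective_pairing.
  rewrite sum_nbrs_step ?(lam_pos k2) //.
  by rewrite addrCA F2_addxx addr0.
have w_kappa u v : a u v -> w (kappa u v).1 (kappa u v).2 = z u v.
  move=> auv; have [k1 k2 k3] := kappaP auv.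
  have t0 u' v' : a u' v' -> t (u', v') (kappa u v).1 (kappa u v).2 = 0.
    move=> /(tP (u', v'))[_ t0 _]; apply: t0; rewrite k2 k3 /=.
    by apply/negP=> /andP[/eqP[e1] /eqP[e2]]; case: (a_neq auv); rewrite e1 e2.
  rewrite /w (bigD1 u) //= (bigD1 v) //= t0 // addr0 pairE !eqxx mulr1.
  have other u' v' : (u', v') != (u, v) -> z u' v' * ((kappa u' v' ==
      ((kappa u v).1, (kappa u v).2))%:R + t (u', v') (kappa u v).1 (kappa u v).2) = 0.
    move=> ne; case auv': (a u' v'); last by rewrite z_off ?auv' // mul0r.
    rewrite t0 // addr0 -surjective_pairing; case: eqP => [ek|]; last by rewrite mulr0.
    by rewrite (kappa_inj auv' auv ek) eqxx in ne.
  rewrite big1 ?addr0 => [|v' nv]; last by apply: other; rewrite xpair_eqE eqxx.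
  rewrite big1 ?addr0 // => u' nu; apply: big1 => v' _; apply: other.
  by rewrite xpair_eqE (negbTE nu).
have w_del p q : deleted_step p q -> w p q = 0.
  move=> [pq lp lq nk]; rewrite /w big1 // => u _; rewrite big1 // => v _.
  case auv: (a u v); last by rewrite z_off ?auv // mul0r.
  have [_ -> //] := tP (u, v) auv; last first.
    by apply/negP=> /andP[/eqP e1 /eqP e2]; case: lq; rewrite e1.
  by rewrite addr0; case: eqP => [/nk|]; rewrite ?mulr0 // => /(_ auv).
have [g gP] := grid_potential w_sym w0 w_bd.
pose gg : {ffun cell -> 'F_2} := [ffun d : cell => g (nat_of_ord d.1, nat_of_ord d.2)].
have ggE p q : lam p <> None -> adj4 p q ->
    w p q = gg (step_cell p q) + gg (step_cell q p).
  move=> lp0 pq; have [v lp] : exists v, lam p = Some v.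
    by case: (lam p) lp0 => // v _; exists v.
  have pp := lam_pos lp; rewrite gP // /gg !ffunE /=.
  have /and4P[p1 p2 p3 p4] : [&& 0 < p.1, 0 < p.2, p.1 <= m & p.2 <= m]%N.
    by case: model => /(_ _ _ lp).
  have lcell : [&& (left_cell p q).1 <= m, (left_cell p q).2 <= m,
      (left_cell q p).1 <= m & (left_cell q p).2 <= m]%N.
    move: pq p1 p2 p3 p4; rewrite /adj4 /left_cell; case: p q {lp lp0 pp} => [i j] [k l] /=.
    by do !case: ifP => /=; lia.
  case/and4P: lcell => c1 c2 c3 c4; rewrite !inordK ?ltnS //.
  by rewrite -!surjective_pairing.
have good : constant_across_deleted gg.
  move=> p q del; have [pq lp _ _] := del; have := ggE p q lp pq.
  by rewrite w_del // => /esym /F2_add_eq0.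
exists (fun phi => phi gg) => x y axy; have [k1 k2 k3] := kappaP axy.
rewrite (face_flip axy) /grid_face !ffunE; case: asboolP => // _.
have lk : lam (kappa x y).1 <> None by rewrite k2.
by rewrite -(w_kappa x y axy) (ggE _ _ lk k1) !ffunE.
Qed.

End F2.

End GridDual.

Lemma grid_model_dual (V : finType) (a : rel V) m lam c :
  symmetric a -> irreflexive a -> grid_model a m lam c ->
  exists (F : finType) (face : V -> V -> F), abstract_dual a face.
Proof.
move=> sym_a irr_a model; have [kappa [k1 k2]] := crossing_exists sym_a irr_a model.
exists _, (@grid_face V a m lam kappa); split.
  exact: (grid_face_cut irr_a model k1 k2).
exact: (grid_face_cycle irr_a model k1 k2).
Qed.

(** * From lattice walks to grid minors *)

(** Scan the walk, keeping the stretch [t0] since the latest visit [p0] to [P], and stop at the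
    first point of [Q]. *)
Lemma path_crossing (T : eqType) (e : rel T) (P Q : pred T) p s :
  (forall x, P x -> ~~ Q x) -> path e p s -> P p -> Q (last p s) ->
  exists p' t q', [/\ P p', Q q', path e p' (rcons t q'),
    all (fun x => ~~ P x && ~~ Q x) t & {subset t <= s}].
Proof.
move=> PQ path_s Pp Qs.
have gen s' p0 t0 : P p0 -> path e p0 t0 -> all (fun x => ~~ P x && ~~ Q x) t0 ->
    path e (last p0 t0) s' -> Q (last (last p0 t0) s') ->
    exists p' t q', [/\ P p', Q q', path e p' (rcons t q'),
      all (fun x => ~~ P x && ~~ Q x) t & {subset t <= t0 ++ s'}].
  elim: s' p0 t0 => [|x s' IHs] p0 t0 Pp0 path0 all0 /=.
    move=> _; case/lastP: t0 path0 all0 => [|t0 y] _; first by rewrite (negbTE (PQ _ Pp0)).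
    by rewrite all_rcons last_rcons => /andP[/andP[_ /negbTE->]].
  case/andP=> ex path_s' Qs'.
  case: (boolP (P x)) => [Px|nPx].
    have [p' [t [q' [h1 h2 h3 h4 h5]]]] := IHs x [::] Px isT isT path_s' Qs'.
    by exists p', t, q'; split=> // y /h5 ys; rewrite mem_cat inE ys !orbT.
  case: (boolP (Q x)) => [Qx|nQx].
    exists p0, t0, x; split=> //; first by rewrite rcons_path path0.
    by move=> y yt; rewrite mem_cat yt.
  have [||||p' [t [q' [h1 h2 h3 h4 h5]]]] := IHs p0 (rcons t0 x) Pp0;
    rewrite ?last_rcons ?rcons_path ?path0 ?all_rcons ?nPx ?nQx //.
  by exists p', t, q'; split=> // y /h5; rewrite cat_rcons.
exact: (gen s p [::]).
Qed.

Definition in_block (k : nat) (c q : nat * nat) : bool :=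
  [&& q.1 <= c.1 + k, c.1 <= q.1 + k, q.2 <= c.2 + k & c.2 <= q.2 + k].

(** Induction on the taxicab distance to the centre, each absolute value being a sum of two
    truncated differences. *)
Lemma block_connected k c q : in_block k c q -> exists s,
  [/\ path adj4 c s, last c s = q & all (in_block k c) (c :: s)].
Proof.
case: c => i j; move: {2}(_ + _)
  (leqnn ((q.1 - i) + (i - q.1) + (q.2 - j) + (j - q.2))) => n.
elim: n q => [|n IHn] [x y] /= le_n blk.
  exists [::]; rewrite /= /in_block /=; split=> //; last lia.
  by congr (_, _); lia.
have base : in_block k (i, j) (i, j) by rewrite /in_block /=; lia.
have step x' y' : (x' - i) + (i - x') + (y' - j) + (j - y') <= n ->
    in_block k (i, j) (x', y') -> adj4 (x', y') (x, y) ->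
    exists s, [/\ path adj4 (i, j) s, last (i, j) s = (x, y)
      & all (in_block k (i, j)) ((i, j) :: s)].
  move=> le' blk' adj'; have [s [h1 h2 h3]] := IHn (x', y') le' blk'.
  exists (rcons s (x, y)); split; rewrite ?rcons_path ?h1 ?h2 ?last_rcons //.
  by rewrite -rcons_cons all_rcons blk.
have [ix|xi|ex] := ltngtP i x.
- by apply: (step x.-1 y); move: blk; rewrite /in_block /adj4 /=; lia.
- by apply: (step x.+1 y); move: blk; rewrite /in_block /adj4 /=; lia.
have [jy|yj|ey] := ltngtP j y.
- by apply: (step x y.-1); move: blk; rewrite /in_block /adj4 /=; lia.
- by apply: (step x y.+1); move: blk; rewrite /in_block /adj4 /=; lia.
by exists [::]; rewrite /= base -ex -ey.
Qed.

Section ModelOfWalks.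

Variables (V : finType) (a : rel V) (c : V -> nat * nat) (k m : nat).
Variable near : {set V} -> nat * nat -> Prop.
Hypotheses (sym_a : symmetric a) (irr_a : irreflexive a).
Local Notation block v := (in_block k (c v)).
Hypothesis block_bounds : forall v,
  [&& k < (c v).1, k < (c v).2, (c v).1 + k <= m & (c v).2 + k <= m].
Hypothesis block_disjoint : forall u v q, block u q -> block v q -> u = v.
Hypothesis near_bounds : forall e q, near e q ->
  [&& 0 < q.1, 0 < q.2, q.1 <= m & q.2 <= m].
Hypothesis near_block : forall e q w, near e q -> block w q -> w \in e.
Hypothesis near_near : forall e f q, near e q -> near f q -> e <> f ->
  exists w, block w q.
Hypothesis walk : forall u v, a u v -> exists s,
  [/\ path adj4 (c u) s, last (c u) s = c v
    & forall q, q \in s -> near [set u; v] q].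

(** A branch set is the block of the vertex plus, for each edge whose lower-ranked end it is, the
    stretch of the walk between the two blocks. These stretches avoid all blocks, so [near_near]
    makes those of distinct edges disjoint. *)
Lemma grid_model_of_walks : exists lam, grid_model a m lam c.
Proof.
have base v : block v (c v) by rewrite /in_block; lia.
have /choice[T TP] : forall uv : V * V,
    exists T : (nat * nat) * seq (nat * nat) * (nat * nat),
    a uv.1 uv.2 -> [/\ block uv.1 T.1.1, block uv.2 T.2,
      path adj4 T.1.1 (rcons T.1.2 T.2),
      all (fun x => ~~ block uv.1 x && ~~ block uv.2 x) T.1.2
    & forall q, q \in T.1.2 -> near [set uv.1; uv.2] q].
  move=> [u v] /=; case auv: (a u v); last by exists ((0, 0), [::], (0, 0)).
  have [s [path_s last_s near_s]] := walk auv.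
  have uv : u <> v by move=> uv; rewrite uv irr_a in auv.
  have disj x : block u x -> ~~ block v x.
    by move=> bu; apply/negP=> /(block_disjoint bu).
  have bl : block v (last (c u) s) by rewrite last_s.
  have [p' [t [q' [h1 h2 h3 h4 h5]]]] := path_crossing disj path_s (base u) bl.
  by exists (p', t, q') => _; split=> // q /h5 /near_s.
pose o (uv : V * V) := a uv.1 uv.2 && (enum_rank uv.1 < enum_rank uv.2).
pose lam q := if [pick w | block w q] is Some w then Some w else
  if [pick uv | o uv && (q \in (T uv).1.2)] is Some uv then Some uv.1 else None.
have lamB w q : block w q -> lam q = Some w.
  move=> bw; rewrite /lam; case: pickP => [w' bw'|/(_ w)]; last by rewrite bw.
  by rewrite (block_disjoint bw bw').
have noB uv q w : o uv -> q \in (T uv).1.2 -> ~~ block w q.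
  move=> /andP[auv _] qt; have [_ _ _ /allP/(_ q qt)/andP[n1 n2] /(_ q qt) nr] := TP uv auv.
  apply/negP=> bw; have := near_block nr bw; rewrite !inE => /orP[] /eqP ew; subst w.
    by rewrite bw in n1.
  by rewrite bw in n2.
have lamT uv q : o uv -> q \in (T uv).1.2 -> lam q = Some uv.1.
  move=> ouv qt; rewrite /lam; case: pickP => [w|_]; first by rewrite (negbTE (noB _ _ _ ouv qt)).
  case: pickP => [uv' /andP[ouv' qt']|/(_ uv)]; last by rewrite ouv qt.
  congr (Some _.1); apply: contrapT => ne.
  have /andP[auv lt] := ouv; have /andP[auv' lt'] := ouv'.
  have [_ _ _ _ /(_ q qt) nr] := TP uv auv; have [_ _ _ _ /(_ q qt') nr'] := TP uv' auv'.
  have [|w bw] := near_near nr nr'; last by have := noB _ _ w ouv qt; rewrite bw.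
  case: uv uv' ne lt lt' {ouv qt nr auv ouv' qt' nr' auv'} => [u v] [u' v'] /= ne lt lt' eq_e.
  have: u \in [set u'; v'] by rewrite -eq_e set21.
  have: v \in [set u'; v'] by rewrite -eq_e set22.
  rewrite !inE => /orP[] /eqP ev /orP[] /eqP eu; subst u v.
  - by rewrite ltnn in lt.
  - by have := ltn_trans lt lt'; rewrite ltnn.
  - by case: ne.
  - by rewrite ltnn in lt.
have lamV q v : lam q = Some v -> block v q \/
    exists2 uv, o uv & q \in (T uv).1.2 /\ uv.1 = v.
  rewrite /lam; case: pickP => [w bw [<-]|_]; first by left.
  by case: pickP => // uv /andP[ouv qt] [<-]; right; exists uv.
have blockP v q : block v q ->
    exists s, [/\ path adj4 (c v) s, last (c v) s = q
      & all (fun q => lam q == Some v) (c v :: s)].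
  move=> /block_connected[s [h1 h2 /allP h3]]; exists s; split=> //.
  by apply/allP=> x /h3 /lamB ->.
exists lam; split.
- move=> q v /lamV[bv|[uv /andP[auv _] [qt _]]].
    by have := block_bounds v; move: bv; rewrite /in_block; lia.
  by have [_ _ _ _ /(_ q qt)] := TP uv auv; apply: near_bounds.
- move=> q v /lamV[/blockP //|[uv ouv [qt <-]]]; have /andP[auv _] := ouv.
  have [bp _ path_t _ _] := TP uv auv; have [s [h1 h2 h3]] := blockP _ _ bp.
  have lt x : x \in (T uv).1.2 -> lam x == Some uv.1 by move=> xt; rewrite (lamT _ _ ouv xt).
  move: (T uv).1.2 qt path_t lt => t qt path_t lt; case/splitPr: qt path_t lt => t1 t2.
  rewrite -cat_rcons rcons_cat cat_path => /andP[path1 _] lt.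
  exists (s ++ rcons t1 q); split; first by rewrite cat_path h1 h2.
    by rewrite last_cat last_rcons.
  rewrite -cat_cons all_cat h3 /=; apply/allP=> x xt; apply: lt.
  by rewrite mem_cat xt.
- have adjo u v : o (u, v) -> exists p q, [/\ adj4 p q, lam p = Some u & lam q = Some v].
    move=> ouv; have /andP[auv _] := ouv; have [bp bq path_t _ _] := TP (u, v) auv.
    (* The last step of the stretch enters the other block, and serves as the required grid edge. *)
    move: path_t; rewrite rcons_path => /andP[_ adj_l].
    exists (last (T (u, v)).1.1 (T (u, v)).1.2), (T (u, v)).2; split=> //; last exact: lamB.
    have := mem_last (T (u, v)).1.1 (T (u, v)).1.2; rewrite inE => /orP[/eqP->|].
      exact: lamB.
    exact: (lamT (u, v)).
  move=> u v auv; have avu : a v u by rewrite sym_a.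
  have: enum_rank u != enum_rank v :> nat.
    rewrite (inj_eq val_inj) (inj_eq enum_rank_inj).
    by apply: contraTneq auv => ->; rewrite irr_a.
  rewrite neq_ltn => /orP[] lt; first by apply: adjo; rewrite /o auv.
  have [|p [q [h1 h2 h3]]] := adjo v u; first by rewrite /o avu.
  by exists q, p; rewrite adj4_sym.
Qed.

End ModelOfWalks.

(** * Rounding arcs *)

From mathcomp Require Import classical_sets set_interval.
From mathcomp Require Import topology prodnormedzmodule normedtype.

Lemma king_move (i j k l : nat) : i <= k.+1 -> k <= i.+1 -> j <= l.+1 -> l <= j.+1 ->
  exists s, [/\ path adj4 (i, j) s, last (i, j) s = (k, l)
    & forall x, x \in s -> x = (k, j) \/ x = (k, l)].
Proof.
move=> ik ki jl lj.
exists ((if i == k then [::] else [:: (k, j)]) ++ (if j == l then [::] else [:: (k, l)])).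
have [ik0|ik0] := eqVneq i k; have [jl0|jl0] := eqVneq j l; rewrite /= ?ik0 ?jl0; split=> //.
- by rewrite /adj4 /=; lia.
- by move=> x; rewrite inE => /eqP->; right.
- by rewrite /adj4 /=; lia.
- by move=> x; rewrite inE => /eqP->; left.
- by rewrite /adj4 /=; lia.
- by move=> x; rewrite !inE => /orP[] /eqP->; [left | right].
Qed.

Section Topology.
Import Order.TTheory GRing.Theory Num.Theory.
Import numFieldNormedType.Exports.
Local Open Scope ring_scope.
Local Open Scope classical_set_scope.
Variable R : realType.

(** The set of distances is compact, hence closed, and omits 0. *)
Lemma compact_separated (K1 K2 : set (R * R)) :
  compact K1 -> compact K2 -> (forall x, K1 x -> ~ K2 x) ->
  exists2 d : R, 0 < d & forall x y, K1 x -> K2 y -> d <= `|x - y|.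
Proof.
move=> cK1 cK2 disj.
pose f (z : (R * R) * (R * R)) : R := `|z.1 - z.2|.
have cf : continuous f.
  by move=> z; apply: cvg_norm; apply: cvgB; [exact: cvg_fst | exact: cvg_snd].
have cK : compact (f @` (K1 `*` K2)).
  apply: continuous_compact; last exact: compact_setX.
  exact: continuous_subspaceT.
have clK := compact_closed (@norm_hausdorff _ _) cK.
have n0 : ~ (f @` (K1 `*` K2)) 0.
  move=> [[x y] /= [K1x K2y] /eqP]; rewrite /f /= normr_eq0 subr_eq0 => /eqP xy.
  by apply: (disj x) => //; rewrite xy.
have opK : open (~` (f @` (K1 `*` K2))) by exact: closed_openC.
have /nbhs_ballP[d /= d0 dP] := open_nbhs_nbhs (conj opK n0).
exists d => // x y K1x K2y; rewrite leNgt; apply/negP => lt.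
apply: (dP (f (x, y))); last by exists (x, y).
by rewrite /ball /= sub0r normrN normr_id.
Qed.

(** Heine-Cantor on the unit interval, with modulus [1 / n] so that [n] equal steps subdivide the
    arc. *)
Lemma arc_uniformly_continuous (g : R -> R * R) (h : R) : 0 < h ->
  {within `[0, 1], continuous g} ->
  exists2 n, (0 < n)%N & forall s t : R, 0 <= s <= 1 -> 0 <= t <= 1 ->
    `|s - t| <= n%:R^-1 -> `|g s - g t| < h.
Proof.
move=> h0 /subspace_continuousP cg.
have /compact_near_coveringP/near_covering_withinP cov := @segment_compact R 0 1.
have nearP : \forall i \near (0 : R)^'+, `[0, 1] `<=`
    (fun s => forall t, 0 <= t <= 1 -> `|s - t| < i -> `|g s - g t| < h).
  apply: cov.
  move=> x /= xI.
  have h2 : 0 < h / 2 by lra.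
  have /cvgrPdist_lt/(_ _ h2) := cg x xI.
  move=> /nbhs_ballP[rho /= rho0 rhoP].
  exists (ball x (rho / 2), [set i | 0 < i < rho / 2]).
    split; first by apply: nbhsx_ballx; lra.
    by near=> i => /=; apply/andP; split; near: i;
      [exact: nbhs_right_gt | apply: nbhs_right_lt; lra].
  move=> [s i] /= [xs /andP[i0 i1]] sI t tI sti.
  have xs' : `|x - s| < rho / 2 by [].
  have xt : `|x - t| < rho.
    by rewrite (le_lt_trans (ler_distD s _ _)) //; lra.
  have gs : `|g x - g s| < h / 2.
    by apply: rhoP => //; rewrite /ball /=; lra.
  have gt : `|g x - g t| < h / 2.
    by apply: rhoP => //=; rewrite in_itv.
  by rewrite (le_lt_trans (ler_distD (g x) _ _)) // distrC; lra.
have [i [i0 iP]] := filter_ex (filterI (nbhs_right_gt (0 : R)) nearP).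
exists (Num.truncn i^-1).+1 => // s t sI tI st.
apply: (iP s) => //.
apply: le_lt_trans st _.
rewrite -[ltRHS]invrK ltf_pV2 ?posrE ?invr_gt0 ?ltr0n //; exact: truncnS_gt.
Unshelve. all: by end_near. Qed.

Definition boxed (b : R) (q : nat * nat) (p : R * R) :=
  [&& q.1%:R - b <= p.1, p.1 <= q.1%:R + b, q.2%:R - b <= p.2 & p.2 <= q.2%:R + b].

Definition round (p : R * R) : nat * nat := (Num.truncn p.1, Num.truncn p.2).

Lemma norm_pair_le (p : R * R) b :
  (`|p| <= b) = [&& - b <= p.1, p.1 <= b, - b <= p.2 & p.2 <= b].
Proof. by rewrite prod_normE ge_max !ler_norml -andbA. Qed.

Lemma norm_pair_lt (p : R * R) b :
  (`|p| < b) = [&& - b < p.1, p.1 < b, - b < p.2 & p.2 < b].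
Proof. by rewrite prod_normE gt_max !ltr_norml -andbA. Qed.

Lemma boxed_round p : 0 <= p.1 -> 0 <= p.2 -> boxed 1 (round p) p.
Proof.
move=> p1 p2; have := truncn_itv p1; have := truncn_itv p2.
rewrite /boxed /round /= -!natr1; lra.
Qed.

(** The rounded points differ by at most 1 in each coordinate. The corner of the move takes one
    coordinate from each of them, which costs distance 2 instead of 1. *)
Lemma round_step (p q : R * R) : 0 <= p.1 -> 0 <= p.2 -> 0 <= q.1 -> 0 <= q.2 ->
  `|p - q| < 1 -> exists s, [/\ path adj4 (round p) s, last (round p) s = round q
    & forall x, x \in s -> boxed 2 x q].
Proof.
move=> p1 p2 q1 q2; rewrite norm_pair_lt => /= pq.
have := boxed_round p1 p2; have := boxed_round q1 q2.
have := truncn_itv p1; have := truncn_itv p2; have := truncn_itv q1; have := truncn_itv q2.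
rewrite /round /=; move: (Num.truncn p.1) (Num.truncn p.2) (Num.truncn q.1) (Num.truncn q.2).
move=> i j k l hl hk hj hi; rewrite /boxed /= => cq cp.
have ltn_real (m n : nat) (x : R) : m%:R <= x -> x < n%:R + 1 -> (m <= n)%N.
  by move=> h1 h2; rewrite -ltnS -(ltr_nat R) -natr1; lra.
rewrite -!natr1 in hl hk hj hi.
have ik : (i <= k.+1)%N by apply: (@ltn_real _ _ p.1); rewrite -?natr1; lra.
have ki : (k <= i.+1)%N by apply: (@ltn_real _ _ q.1); rewrite -?natr1; lra.
have jl : (j <= l.+1)%N by apply: (@ltn_real _ _ p.2); rewrite -?natr1; lra.
have lj : (l <= j.+1)%N by apply: (@ltn_real _ _ q.2); rewrite -?natr1; lra.
have [s [h1 h2 h3]] := king_move ik ki jl lj; exists s; split=> // x /h3[] ->;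
  rewrite /boxed /=; lra.
Qed.

Lemma round_walk (g : R -> R * R) n : (0 < n)%N ->
  (forall s t : R, 0 <= s <= 1 -> 0 <= t <= 1 ->
    `|s - t| <= n%:R^-1 -> `|g s - g t| < 1) ->
  (forall t, 0 <= t <= 1 -> 0 <= (g t).1 /\ 0 <= (g t).2) ->
  exists s, [/\ path adj4 (round (g 0)) s, last (round (g 0)) s = round (g 1)
    & forall x, x \in s -> exists2 t, 0 <= t <= 1 & boxed 2 x (g t)].
Proof.
move=> n0 unif pos.
have n0R : 0 < n%:R :> R by rewrite ltr0n.
have steps i : (i <= n)%N -> exists s,
    [/\ path adj4 (round (g 0)) s, last (round (g 0)) s = round (g (i%:R / n%:R))
    & forall x, x \in s -> exists2 t, 0 <= t <= 1 & boxed 2 x (g t)].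
  elim: i => [|i IHi] lt_in; first by exists [::]; rewrite mul0r.
  have inI j : (j <= n)%N -> 0 <= (j%:R / n%:R : R) <= 1.
    by move=> jn; rewrite divr_ge0 //= ler_pdivrMr // mul1r ler_nat.
  have [s [h1 h2 h3]] := IHi (ltnW lt_in).
  have iI := inI i (ltnW lt_in); have i1I := inI i.+1 lt_in.
  have [p1 p2] := pos _ iI; have [q1 q2] := pos _ i1I.
  have [|s' [k1 k2 k3]] := round_step p1 p2 q1 q2.
    apply: unif => //; rewrite -mulrBl -natr1 opprD addrA subrr add0r mulN1r normrN.
    by rewrite ger0_norm // invr_ge0 ltW.
  exists (s ++ s'); split.
  - by rewrite cat_path h1 h2.
  - by rewrite last_cat h2.
  - move=> x; rewrite mem_cat => /orP[/h3 //|/k3 cx]; exists (i.+1%:R / n%:R) => //.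
by have := steps n (leqnn n); rewrite divff // gt_eqF.
Qed.

End Topology.

(** * From a well-separated drawing to a grid minor *)

Section Drawing.
Import Order.TTheory GRing.Theory Num.Theory.
Import numFieldNormedType.Exports.
Local Open Scope ring_scope.
Variable R : realType.

Lemma in_block_real k (c q : nat * nat) : in_block k c q ->
  [&& q.1%:R <= c.1%:R + k%:R :> R, c.1%:R <= q.1%:R + k%:R :> R,
      q.2%:R <= c.2%:R + k%:R :> R & c.2%:R <= q.2%:R + k%:R :> R].
Proof. by rewrite -!natrD !ler_nat. Qed.

(** Blocks have radius [2N] about points within 1 of the vertices, and walks stay within 2 of the
    arcs. As [N >= 3], [4N + 2 < 8N] keeps blocks disjoint and [2N + 3 < 8N] keeps walks out of
    foreign blocks. Two arcs near one lattice point are at distance at most [4 < 5] there, hence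
    near a common end, whose block contains the point as [N + 3 <= 2N]. *)
Lemma grid_model_of_drawing (G : sgraph) (P : G -> R * R)
    (arc : {set G} -> R -> R * R) (N B : nat) :
  (3 <= N)%N ->
  (forall u v, u != v -> 8 * N%:R <= `|P u - P v|) ->
  (forall e w (t : R), e \in edges G -> w \notin e -> 0 <= t <= 1 ->
     8 * N%:R <= `|arc e t - P w|) ->
  (forall e f (s t : R), e \in edges G -> f \in edges G -> e != f ->
     0 <= s <= 1 -> 0 <= t <= 1 ->
     (forall u, u \in e -> u \in f -> N%:R <= `|arc e s - P u|) ->
     5 <= `|arc e s - arc f t|) ->
  (forall e, e \in edges G -> exists2 n, (0 < n)%N &
     forall s t : R, 0 <= s <= 1 -> 0 <= t <= 1 ->
     `|s - t| <= n%:R^-1 -> `|arc e s - arc e t| < 1) ->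
  (forall e, e \in edges G -> exists x y,
     [/\ e = [set x; y]%SET, arc e 0 = P x & arc e 1 = P y]) ->
  (forall u, [&& 3 * N%:R <= (P u).1, (P u).1 <= B%:R,
                 3 * N%:R <= (P u).2 & (P u).2 <= B%:R]) ->
  (forall e (t : R), e \in edges G -> 0 <= t <= 1 ->
     [&& 3 * N%:R <= (arc e t).1, (arc e t).1 <= B%:R,
                 3 * N%:R <= (arc e t).2 & (arc e t).2 <= B%:R]) ->
  exists m lam c, grid_model (@adj G) m lam c.
Proof.
move=> N3 PP PA AA unif ends boundP boundA.
have N3R : 3 <= N%:R :> R by rewrite (ler_nat R 3).
pose c u := round (P u).
have cP u : boxed 1 (c u) (P u) by apply: boxed_round; have := boundP u; lra.
pose near e (q : nat * nat) := e \in edges G /\ exists2 t : R, 0 <= t <= 1 & boxed 2 q (arc e t).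
have [K natR2] : exists K, K%:R = 2 * N%:R :> R by exists (2 * N)%N; rewrite natrM.
exists (B + K + 3)%N.
suff [lam mod] : exists lam, grid_model (@adj G) (B + K + 3)%N lam c by exists lam, c.
apply: (@grid_model_of_walks G (@adj G) c K (B + K + 3)%N near).
- exact: adj_sym.
- exact: adj_irrefl.
- move=> v; have := boundP v; have := cP v; rewrite /boxed.
  move=> /and4P[c1 c2 c3 c4] /and4P[b1 b2 b3 b4].
  by apply/and4P; split; [rewrite -(ltr_nat R) natR2 | rewrite -(ltr_nat R) natR2
    | rewrite -(ler_nat R) !natrD natR2 | rewrite -(ler_nat R) !natrD natR2]; lra.
- move=> u v q /in_block_real bu /in_block_real bv; apply/eqP; apply: contraT => uv.
  have := PP u v uv; rewrite leNgt norm_pair_lt /=.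
  have := cP u; have := cP v; rewrite /boxed; move: bu bv; rewrite natR2.
  by move=> /and4P[? ? ? ?] /and4P[? ? ? ?] /and4P[? ? ? ?] /and4P[? ? ? ?] /negP[]; lra.
- move=> e q [eE [t tI ct]]; have := boundA e t eE tI; move: ct; rewrite /boxed.
  move=> /and4P[c1 c2 c3 c4] /and4P[b1 b2 b3 b4].
  by apply/and4P; split; rewrite -?(ltr_nat R) -?(ler_nat R) ?natrD ?natR2; lra.
- move=> e q w [eE [t tI ct]] /in_block_real bw; apply: contraT => we.
  have := PA e w t eE we tI; rewrite leNgt norm_pair_lt /=.
  have := cP w; move: ct; rewrite /boxed; move: bw; rewrite natR2.
  by move=> /and4P[? ? ? ?] /and4P[? ? ? ?] /and4P[? ? ? ?] /negP[]; lra.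
- move=> e f q [eE [s sI cs]] [fE [t tI ct]] /eqP ef.
  have [[u [ue uf lt]]|none] := pselect (exists u, [/\ u \in e, u \in f & `|arc e s - P u| < N%:R]).
    exists u; have := cP u; move: lt cs; rewrite norm_pair_lt /boxed /in_block /=.
    move=> /and4P[? ? ? ?] /and4P[? ? ? ?] /and4P[? ? ? ?].
    by apply/and4P; split; rewrite -(ler_nat R) natrD natR2; lra.
  have far u : u \in e -> u \in f -> N%:R <= `|arc e s - P u|.
    by move=> ue uf; rewrite leNgt; apply/negP => lt; apply: none; exists u.
  have := AA e f s t eE fE ef sI tI far; rewrite leNgt norm_pair_lt /=.
  by move: cs ct; rewrite /boxed => /and4P[? ? ? ?] /and4P[? ? ? ?] /negP[]; lra.
- move=> u v uv; set e := [set u; v]%SET.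
  have eE : e \in edges G.
    by rewrite inE; apply/existsP; exists u; apply/existsP; exists v; rewrite uv eqxx.
  have [n n0 nP] := unif e eE.
  have pos t : 0 <= t <= 1 -> 0 <= (arc e t).1 /\ 0 <= (arc e t).2.
    by move=> tI; have /and4P[? ? ? ?] := boundA e t eE tI; lra.
  have [x [y [exy e0 e1]]] := ends e eE.
  have uv' : u <> v by move=> uv'; rewrite uv' adj_irrefl in uv.
  have [[ux vy]|[uy vx]] : (u = x /\ v = y) \/ (u = y /\ v = x).
    have: u \in [set x; y]%SET by rewrite -exy set21.
    have: v \in [set x; y]%SET by rewrite -exy set22.
    rewrite !inE => /orP[] /eqP ev /orP[] /eqP eu;
      [case: uv' | right | left | case: uv']; by rewrite ?eu ?ev.
  - have [s [h1 h2 h3]] := round_walk n0 nP pos.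
    exists s; rewrite /c ux vy -e0 -e1; split=> // q /h3[t tI ct].
    by split=> //; exists t.
  (* The arc is parametrised from [v] to [u], so it is traversed backwards. *)
  - pose g t := arc e (1 - t).
    have flip (t : R) : 0 <= t <= 1 -> 0 <= 1 - t <= 1 by lra.
    have [||s [h1 h2 h3]] := @round_walk R g n n0.
    + move=> s t sI tI st; apply: nP; rewrite ?flip //.
      by rewrite (_ : 1 - s - (1 - t) = t - s) 1?distrC //; lra.
    + by move=> t tI; apply: pos; apply: flip.
    exists s; rewrite /c uy vx -e0 -e1.
    move: h1 h2; rewrite /g subr0 subrr => h1 h2; split=> // q /h3[t tI ct].
    by split=> //; exists (1 - t); rewrite ?flip.
Qed.

Lemma finite_positive (I : finType) (Q : I -> R -> Prop) :
  (forall i, exists2 d, 0 < d & Q i d) ->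
  (forall i d d', d' <= d -> Q i d -> Q i d') ->
  exists2 d, 0 < d & forall i, Q i d.
Proof.
move=> exQ mono.
have gen (s : seq I) : exists2 d, 0 < d & forall i, i \in s -> Q i d.
  elim: s => [|i s [d d0 dP]]; first by exists 1.
  have [d' d'0 d'P] := exQ i; exists (Num.min d d').
    by rewrite lt_min d0.
  move=> j; rewrite inE => /orP[/eqP->|/dP].
    by apply: mono d'P; rewrite ge_min lexx orbT.
  by apply: mono; rewrite ge_min lexx.
have [d d0 dP] := gen (enum I); exists d => // i.
by apply: dP; rewrite mem_enum.
Qed.

End Drawing.

(** * Separation and scaling of a plane drawing *)

Section PlaneGraph.
Import Order.TTheory GRing.Theory Num.Theory.
Import numFieldNormedType.Exports.
Local Open Scope ring_scope.
Local Open Scope classical_set_scope.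
Variables (R : realType) (G : plane_graph R).

Local Notation P := (@Defs.point R G).
Local Notation arc := (@edge_arc R G).

Let unit_cases (t : R) : 0 <= t <= 1 -> [\/ t = 0, t = 1 | t \in `]0, 1[%R].
Proof.
move=> /andP[t0 t1]; have [->|n0] := eqVneq t 0; first by constructor 1.
have [->|n1] := eqVneq t 1; first by constructor 2.
by constructor 3; rewrite in_itv /= !lt_neqAle eq_sym n0 t0 n1 t1.
Qed.

Let arc_ends e : e \in edges G -> exists x y,
  [/\ e = [set x; y]%SET, arc e 0 = P x & arc e 1 = P y].
Proof. exact: edge_arc_ends. Qed.

Lemma edge_arc_point e w (t : R) : e \in edges G -> 0 <= t <= 1 ->
  arc e t = P w -> w \in e.
Proof.
move=> eE tI ew; have [x [y [exy e0 e1]]] := arc_ends eE.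
case: (unit_cases tI) => ht.
- by move: ew; rewrite ht e0 => /point_inj <-; rewrite exy set21.
- by move: ew; rewrite ht e1 => /point_inj <-; rewrite exy set22.
- by case: (@edge_arc_vertex _ _ e eE t ht w).
Qed.

Lemma edge_arc_meet e f (s t : R) : e \in edges G -> f \in edges G -> e <> f ->
  0 <= s <= 1 -> 0 <= t <= 1 -> arc e s = arc f t ->
  exists u, [/\ u \in e, u \in f & arc e s = P u].
Proof.
move=> eE fE ef sI tI est; have [x [y [exy e0 e1]]] := arc_ends eE.
case: (unit_cases sI) => hs.
- have xe : x \in e by rewrite exy set21.
  exists x; rewrite hs e0; split=> //.
  by apply: (@edge_arc_point f x t) => //; rewrite -est hs e0.
- have ye : y \in e by rewrite exy set22.
  exists y; rewrite hs e1; split=> //.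
  by apply: (@edge_arc_point f y t) => //; rewrite -est hs e1.
- by case: (@edge_arc_disjoint _ _ e f eE fE ef s t hs); rewrite ?in_itv.
Qed.

Let arc_compact e : e \in edges G -> compact (arc e @` `[0, 1]).
Proof.
move=> eE; apply: continuous_compact; first exact: edge_arc_continuous.
exact: segment_compact.
Qed.

Let closed_far (u : G) (r : R) : closed [set p : R * R | r <= `|p - P u|].
Proof.
have -> : [set p : R * R | r <= `|p - P u|] =
    (fun p : R * R => `|p - P u|) @^-1` [set x | r <= x] by [].
apply: preimage_closed; last exact: closed_ge.
by move=> p _; apply: cvg_norm; apply: cvgB; [exact: cvg_id | exact: cvg_cst].
Qed.

Lemma vertices_separated : exists2 r : R, 0 < r &
  (forall u v : G, u != v -> 8 * r <= `|P u - P v|) /\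
  (forall e w (t : R), e \in edges G -> w \notin e -> 0 <= t <= 1 ->
     8 * r <= `|arc e t - P w|).
Proof.
have [r1 r10 r1P] : exists2 r : R, 0 < r & forall uv : G * G,
    uv.1 != uv.2 -> r <= `|P uv.1 - P uv.2|.
  apply: finite_positive => [[u v]|i d d' dd' h /h] /=; last exact: le_trans.
  have [->|uv] := eqVneq u v; first by exists 1.
  exists `|P u - P v| => //; rewrite normr_gt0 subr_eq0.
  by apply: contra_neq uv; apply: Defs.point_inj.
have [r2 r20 r2P] : exists2 r : R, 0 < r & forall ew : {set G} * G,
    ew.1 \in edges G -> ew.2 \notin ew.1 -> forall t : R, 0 <= t <= 1 ->
    r <= `|arc ew.1 t - P ew.2|.
  apply: finite_positive => [[e w]|i d d' dd' h h1 h2 t tI] /=; last first.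
    by apply: le_trans dd' _; apply: h.
  have [eE|] := boolP (e \in edges G); last by exists 1.
  have [|we] := boolP (w \in e); first by exists 1.
  have [|d d0 dP] := compact_separated (arc_compact eE) (@compact_set1 _ (P w)).
    move=> p [t tI <-] /= ew; case/negP: we; exact: (@edge_arc_point e w t).
  by exists d => // _ _ t tI; apply: dP => //; exists t.
exists (Num.min r1 r2 / 8); first by rewrite divr_gt0 // lt_min r10.
have E : 8 * (Num.min r1 r2 / 8) = Num.min r1 r2 by lra.
rewrite E; split.
  by move=> u v uv; rewrite ge_min (r1P (u, v)).
by move=> e w t eE we tI; rewrite ge_min (r2P (e, w)) ?orbT.
Qed.

(** Arcs meet only at common ends, so the part of one arc outside the open [r]-balls about these
    ends is compact and disjoint from the other arc. *)
Lemma arcs_separated (r : R) : 0 < r -> exists2 d : R, 0 < d &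
  forall e f (s t : R), e \in edges G -> f \in edges G -> e != f ->
    0 <= s <= 1 -> 0 <= t <= 1 ->
    (forall u, u \in e -> u \in f -> r <= `|arc e s - P u|) ->
    d <= `|arc e s - arc f t|.
Proof.
move=> r0.
suff [d d0 dP] : exists2 d : R, 0 < d & forall ef : {set G} * {set G},
    ef.1 \in edges G -> ef.2 \in edges G -> ef.1 != ef.2 ->
    forall s t : R, 0 <= s <= 1 -> 0 <= t <= 1 ->
    (forall u, u \in ef.1 -> u \in ef.2 -> r <= `|arc ef.1 s - P u|) ->
    d <= `|arc ef.1 s - arc ef.2 t|.
  by exists d => // e f s t eE fE ef sI tI; apply: (dP (e, f)).
apply: finite_positive => [[e f]|i d d' dd' h h1 h2 h3 s t sI tI h4] /=; last first.
  by apply: le_trans dd' _; apply: h.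
have [eE|] := boolP (e \in edges G); last by exists 1.
have [fE|] := boolP (f \in edges G); last by exists 1.
have [|ef] := eqVneq e f; first by exists 1.
pose far := \bigcap_(u in [set u | (u \in e) && (u \in f)])
  [set p : R * R | r <= `|p - P u|].
have cfar : closed far by apply: closed_bigI => u _; apply: closed_far.
have cK1 := compact_closedI (arc_compact eE) cfar.
have [|d d0 dP] := compact_separated cK1 (arc_compact fE).
  move=> p [[s sI es] pfar] [t tI ft].
  have est : arc e s = arc f t by rewrite es ft.
  have [u [ue uf eu]] := edge_arc_meet eE fE (elimN eqP ef) sI tI est.
  have := pfar u; rewrite /= ue uf => /(_ isT).
  by rewrite -es eu subrr normr0 leNgt r0.
exists d => // _ _ _ s t sI tI farP; apply: dP.
  split; first by exists s.
  by move=> u /= /andP[ue uf]; apply: farP.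
by exists t.
Qed.

Lemma drawing_bounded : exists2 b : R, 0 < b &
  (forall u : G, `|P u| <= b) /\
  (forall e (t : R), e \in edges G -> 0 <= t <= 1 -> `|arc e t| <= b).
Proof.
(* Upper bounds are stated as [d * x <= 1], which persists when [d] shrinks, so that
   [finite_positive] applies. *)
have inv_bound (x : R) : 0 <= x -> exists2 d : R, 0 < d & d * x <= 1.
  move=> x0; exists (1 + x)^-1; first by rewrite invr_gt0; lra.
  by rewrite mulrC ler_pdivrMr; lra.
have [d1 d10 d1P] : exists2 d : R, 0 < d & forall u : G, d * `|P u| <= 1.
  apply: finite_positive => [u|u d d' dd']; first exact: inv_bound.
  by apply: le_trans; rewrite ler_wpM2r.
have [d2 d20 d2P] : exists2 d : R, 0 < d & forall e : {set G}, e \in edges G ->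
    forall t : R, 0 <= t <= 1 -> d * `|arc e t| <= 1.
  apply: finite_positive => [e|e d d' dd' h eE t tI]; last first.
    by apply: le_trans (h eE t tI); rewrite ler_wpM2r.
  have [eE|] := boolP (e \in edges G); last by exists 1.
  have /pinfty_ex_gt0[M M0 MP] := compact_bounded (arc_compact eE).
  have [d d0 dM] := inv_bound M (ltW M0); exists d => // _ t tI.
  by apply: le_trans dM; rewrite ler_pM2l //; apply: MP; exists t.
have d0 : 0 < Num.min d1 d2 by rewrite lt_min d10.
exists (Num.min d1 d2)^-1; first by rewrite invr_gt0.
split=> [u|e t eE tI]; rewrite -[leRHS]mul1r ler_pdivlMr // mulrC.
  by apply: le_trans (d1P u); rewrite ler_wpM2r // ge_min lexx.
by apply: le_trans (d2P e eE t tI); rewrite ler_wpM2r // ge_min lexx orbT.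
Qed.

Theorem plane_graph_grid_model : exists m lam c, grid_model (@adj G) m lam c.
Proof.
have [r r0 [sepP sepA]] := vertices_separated.
have [d d0 sepAA] := arcs_separated r0.
have [b b0 [bP bA]] := drawing_bounded.
have natr_above (x : R) : exists n : nat, x <= n%:R.
  by exists (Num.truncn x).+1; apply: ltW; apply: truncnS_gt.
have [N N3 dN] : exists2 N : nat, (3 <= N)%N & 5 * r / d <= N%:R.
  have [n nP] := natr_above (5 * r / d); exists (n + 3)%N; first exact: leq_addl.
  by rewrite natrD; lra.
(* Dividing by [h] turns the radius [r] into [N] and the separation [d] into at least 5, by the
   choice of [N]. *)
pose h := r / N%:R.
have N0 : 0 < N%:R :> R by rewrite ltr0n; apply: leq_trans N3.
have h0 : 0 < h by rewrite divr_gt0.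
have hN : h * N%:R = r by rewrite mulfVK // gt_eqF.
have h5 : 5 * h <= d.
  by rewrite /h mulrA ler_pdivrMr // [d * _]mulrC -ler_pdivrMr.
have [M bM] := natr_above (b / h + 3 * N%:R).
(* Scaled coordinates are at most [b / h] in absolute value, so the shift by [M] puts them between
   [3N] and [2M]. *)
pose sc (p : R * R) : R * R := h^-1 *: p + (M%:R, M%:R).
have scB p q : `|sc p - sc q| = h^-1 * `|p - q|.
  rewrite /sc opprD addrACA subrr addr0 -scalerBr normrZ ger0_norm //.
  by rewrite invr_ge0 ltW.
have scale x y : x * h <= y -> x <= h^-1 * y.
  by move=> xy; rewrite mulrC ler_pdivlMr.
have sc_bound p : `|p| <= b -> [&& 3 * N%:R <= (sc p).1, (sc p).1 <= (2 * M)%N%:R,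
    3 * N%:R <= (sc p).2 & (sc p).2 <= (2 * M)%N%:R].
  move=> pb; have := norm_pair_le (h^-1 *: p) (b / h).
  rewrite normrZ ger0_norm ?invr_ge0 ?(ltW h0) // mulrC ler_pM2r ?invr_gt0 // pb.
  rewrite /sc; move: (h^-1 *: p) => y /esym /and4P[? ? ? ?].
  by rewrite /= natrM; apply/and4P; split; lra.
apply: (@grid_model_of_drawing R G (fun u => sc (P u)) (fun e t => sc (arc e t)) N (2 * M)%N).
- by [].
- by move=> u v uv; rewrite scB; apply: scale; rewrite -mulrA [N%:R * h]mulrC hN sepP.
- move=> e w t eE we tI; rewrite scB; apply: scale.
  by rewrite -mulrA [N%:R * h]mulrC hN sepA.
- move=> e f s t eE fE ef sI tI far; rewrite scB; apply: scale.
  apply: le_trans h5 _; apply: sepAA => // u ue uf.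
  have := far u ue uf; rewrite scB mulrC ler_pdivlMr //.
  by rewrite mulrC hN.
- move=> e eE; have [n n0 nP] := arc_uniformly_continuous h0 (edge_arc_continuous eE).
  exists n => // s t sI tI st; rewrite scB mulrC ltr_pdivrMr // mul1r.
  exact: nP.
- move=> e eE; have [x [y [exy e0 e1]]] := arc_ends eE; exists x, y.
  by rewrite e0 e1.
- by move=> u; apply: sc_bound; apply: bP.
- by move=> e t eE tI; apply: sc_bound; apply: bA.
Qed.

End PlaneGraph.

Theorem theorem6p2 (R : realType) (G : plane_graph R) (C : choiceType)
    (LV : G -> {fset C}) (LE : {set G} -> {fset C})
    (hDelta : 11 <= max_degree G)
    (hLV : forall x : G, #|` LV x| = max_degree G)
    (hLE : forall e : {set G}, e \in edges G -> #|` LE e| = max_degree G + 2) :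
  exists (cV : G -> C) (cE : {set G} -> C), total_list_coloring LV LE cV cE.
Proof.
have [m [lam [c model]]] := plane_graph_grid_model G.
case: (pickP (fun _ : G => true)) => [x0 _|G0]; last first.
  by move: hDelta; rewrite /max_degree big_pred0.
apply: (total_coloring_of_light_edges x0 hDelta hLV hLE) => a sym_a sub_a ex_a.
have irr_a : irreflexive a by move=> x; apply/negP=> /sub_a; rewrite adj_irrefl.
have [F [face dual]] := grid_model_dual sym_a irr_a (grid_model_sub sub_a model).
have [x [y [axy light]]] := light_edge_exists sym_a irr_a dual ex_a.
have dy : rdeg a y <= max_degree G.
  apply: leq_trans (leq_bigmax y); apply: subset_leq_card.
  by apply/fintype.subsetP=> z; rewrite !inE => /sub_a.
(* If [rdeg a x <= 2], the bound on [rdeg a y] gives the sum; otherwise [13 <= max_degree G + 2]. *)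
exists x, y; split=> //; move: (rdeg a x) (rdeg a y) light dy.
  by clear; lia.
by move: (max_degree G) hDelta; clear; lia.
Qed.
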